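(* Let $(x_n)_{n\ge 0}$ be the rancher process in $\mathbb{R}^2$ (that is, $x_0=0$, and for every $n\ge 0$, given $x_0,\dots,x_n$, the point $x_{n+1}$ is uniformly distributed on the circle of radius $1$ centered at $x_n$, conditioned on the event that the segment $\overline{x_n x_{n+1}}$ does not intersect the interior of the convex hull of $\{x_0,\dots,x_n\}$). Then there exists a (deterministic) constant $s>0$ such that $$\limsup_{n\to\infty} \frac{\|x_n\|}{n} \ \ge\ s \quad\text{almost surely.}$$
   Context: The rancher process in $\mathbb{R}^d$ (here $d=2$) is the random sequence of points $x_0,x_1,x_2,\dots\in\mathbb{R}^d$ defined inductively as follows. Set $x_0=0$. Given $x_0,\dots,x_n$, let $K_n$ be the convex hull of $\{x_0,\dots,x_n\}$, and let $S_n$ be the set of points $y$ with $\|y-x_n\|=1$ such that the closed line segment $\overline{x_n y}$ does not intersect the (topological, in $\mathbb{R}^d$) interior of $K_n$. The conditional law of $x_{n+1}$ given $x_0,\dots,x_n$ is the normalized restriction to $S_n$ of the uniform (surface/arc-length) measure on the unit sphere centered at $x_n$. When $K_n$ has empty interior (e.g. $n=0,1$) there is no restriction, and $x_{n+1}$ is uniform on the whole unit sphere around $x_n$. $\|\cdot\|$ denotes the Euclidean norm. *)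

(* Defs.v *)
From HB Require Import structures.
From mathcomp Require Export all_boot all_order all_algebra.
From mathcomp Require Export all_classical all_reals all_analysis.
Export Order.TTheory GRing.Theory Num.Theory.
Export numFieldNormedType.Exports.

Set Implicit Arguments.
Unset Strict Implicit.
Unset Printing Implicit Defensive.

Local Open Scope classical_set_scope.
Local Open Scope ring_scope.

Section Rancher.
Context {R : realType}.
Local Notation plane := (R * R)%type.

(* The library norm [`|v|] on [R * R] is the sup norm; its topology and its
   Borel sigma-algebra are the Euclidean ones. *)
Definition enorm (v : plane) : R := Num.sqrt (v.1 ^+ 2 + v.2 ^+ 2).

Definition closed_segment (a b : plane) : set plane :=
  [set (1 - t) *: a + t *: b | t in `[0, 1]].

Definition convex_hull (A : set plane) : set plane :=
  smallest (@convex_set R plane) A.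

Definition hull_upto (x : nat -> plane) (n : nat) : set plane :=
  convex_hull [set x i | i in `I_n.+1].

Definition allowed (x : nat -> plane) (n : nat) : set plane :=
  [set y | enorm (y - x n) = 1 /\
           closed_segment (x n) y `&` interior (hull_upto x n) = set0].

(* Arc-length measure of the unit circle centered at [p]: the image of Lebesgue
   measure on [0, 2 pi[ under the unit-speed parametrization. *)
Definition arc_length (p : plane) (B : set plane) : \bar R :=
  lebesgue_measure
    (`[0, 2 * pi[ `&` (fun t : R => p + (cos t, sin t)) @^-1` B).

(* The denominator is at least [pi] along the process, since [x n] is then
   never in the interior of [hull_upto x n]. *)
Definition step_law (x : nat -> plane) (n : nat) (B : set plane) : R :=
  fine (arc_length (x n) (allowed x n `&` B)) /
  fine (arc_length (x n) (allowed x n)).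

Definition history (T : Type) (x : nat -> T -> plane) (n : nat) :
    set (set T) :=
  <<s \bigcup_(i in `I_n.+1) preimage_set_system setT (x i) measurable >>.

(* The last clause says that [step_law] is a version of the conditional law of
   [x n.+1] given the sigma-algebra generated by [x 0], ..., [x n]. *)
Definition rancher_process (d : measure_display) (T : measurableType d)
    (P : probability T R) (x : nat -> T -> plane) : Prop :=
  [/\ forall n, measurable_fun setT (x n),
      forall w, x 0%N w = 0 &
      forall (n : nat) (E : set T) (B : set plane),
        history x n E -> measurable B ->
        P (E `&` x n.+1 @^-1` B) =
        (\int[P]_(w in E) (step_law (fun i => x i w) n B)%:E)%E].

End Rancher.

(* Main.v *)
(* If the hull of the path has [v] as an outer normal at its newest point [x n],
   then a half circle of steps [u] with [u.v >= 0] is allowed, so the height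
   [max_(i <= n) x i . v] increases by a definite amount with probability bounded
   below.  Fix eight test directions.  Whenever none of them is a normal at
   [x n], the normal cone lies inside one open octant, and it stays there until a
   test direction becomes normal, because consecutive normal cones intersect.
   Meanwhile the allowed steps have a positive mean along both directions
   bordering the octant, and one of these was at bounded gap from being normal
   when the cone entered the octant.  Hence, with [deficit] the smaller of the
   two gaps (or [0] if a test direction is normal) and [heights] the sum of the
   heights, [20 * heights - deficit] has conditional drift bounded below by a
   positive constant.  The heights therefore cannot remain below [c * n] for a
   small [c]. *)

Require Import Defs.
From mathcomp Require Import measurable_realfun ring lra.
Set Implicit Arguments.
Unset Strict Implicit.
Unset Printing Implicit Defensive.
Local Open Scope classical_set_scope.
Local Open Scope ring_scope.

Section Plane.
Context {R : realType}.
Local Notation plane := (R * R)%type.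
Implicit Types (u v w z : plane) (x : nat -> plane).

(** The mean along a border direction is positive by a count of octants of arc. The two octants
    bordering it are allowed and raise it by at least [thr]. An allowed step that lowers it must
    raise the other border direction, since otherwise it would lower every normal; this confines it
    to one octant. So hits are at least twice as likely as retreats, which suffices because
    [bnd i < 2 * thr i]. Measurability of [allowed] and of [step_law] is never established. The
    drift is therefore assembled from inequalities between probabilities of half-plane events, which
    follow from monotonicity of outer measure and of lower integrals. Two further obstacles concern
    time. While the path stays on a line, opposite normals coexist and the octant is not determined;
    this phase has a geometric tail. And being slow forever is not an event of a finite history, so
    the drift is applied on [slow_upto N m], whose excess over [slow_from N] vanishes as [m]
    grows. *)

Definition dot u v : R := u.1 * v.1 + u.2 * v.2.
Definition det u v : R := u.1 * v.2 - u.2 * v.1.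
Definition perp u : plane := (- u.2, u.1).

Lemma dotDl u v z : dot (u + v) z = dot u z + dot v z.
Proof. rewrite /dot /=; ring. Qed.

Lemma dotBl u v z : dot (u - v) z = dot u z - dot v z.
Proof. rewrite /dot /=; ring. Qed.

Lemma dotNr u v : dot u (- v) = - dot u v.
Proof. rewrite /dot /=; ring. Qed.

Lemma dotDr u v z : dot z (u + v) = dot z u + dot z v.
Proof. rewrite /dot /=; ring. Qed.

Lemma dotZr (a : R) u v : dot u (a *: v) = a * dot u v.
Proof. rewrite /dot /= /GRing.scale /=; ring. Qed.

Lemma dotZl (a : R) u v : dot (a *: u) v = a * dot u v.
Proof. rewrite /dot /= /GRing.scale /=; ring. Qed.

Lemma dot0l v : dot 0 v = 0.
Proof. rewrite /dot /=; ring. Qed.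

Lemma det_perp u v : dot u (perp v) = det v u.
Proof. rewrite /dot /det /=; ring. Qed.

Lemma planeZ (a : R) u : a *: u = (a * u.1, a * u.2).
Proof. by []. Qed.

Lemma plane_neq0 u : u != 0 -> 0 < dot u u.
Proof.
case: u => a b; rewrite /dot /= -!expr2 => h.
rewrite lt_def paddr_eq0 ?sqr_ge0// !sqrf_eq0 addr_ge0 ?sqr_ge0// andbT.
by apply: contra h => /andP[/eqP-> /eqP->].
Qed.

(** * Support gaps and the normal cone of the hull at its newest point *)

(* The base value [0] is harmless: the term [i = n] vanishes. *)
Definition gap x n z : R := \big[Num.max/0]_(i < n.+1) dot (x i - x n) z.

Definition supp x n z : bool := gap x n z <= 0.

Lemma gap_ge0 x n z : 0 <= gap x n z.
Proof. exact: bigmax_ge_id. Qed.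

Lemma gap_ge x n z i : (i <= n)%N -> dot (x i - x n) z <= gap x n z.
Proof.
move=> lin; rewrite /gap.
by rewrite (bigD1 (Ordinal (lin : (i < n.+1)%N)))//= le_max lexx.
Qed.

Lemma gap_le x n z c : 0 <= c -> (forall i, (i <= n)%N -> dot (x i - x n) z <= c) ->
  gap x n z <= c.
Proof.
move=> c0 h; rewrite /gap; elim/big_ind: _ => // [a b ac bc|i _].
  by rewrite ge_max ac.
by apply: h; rewrite -ltnS.
Qed.

Lemma suppP x n z :
  reflect (forall i, (i <= n)%N -> dot (x i - x n) z <= 0) (supp x n z).
Proof.
apply: (iffP idP) => [h i lin|h]; last exact: gap_le.
exact: le_trans (gap_ge x z lin) h.
Qed.

Lemma supp_gap x n z : supp x n z -> gap x n z = 0.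
Proof. by move=> h; apply/eqP; rewrite eq_le gap_ge0 andbT. Qed.

(** Moving the base point from [x n] to [x n.+1] shifts all old terms by the same amount, and the
    new index contributes [0]. *)
Lemma gapS x n z :
  gap x n.+1 z = Num.max 0 (gap x n z - dot (x n.+1 - x n) z).
Proof.
apply/eqP; rewrite eq_le; apply/andP; split.
  apply: gap_le => [|i]; first by rewrite le_max lexx.
  rewrite leq_eqVlt => /orP[/eqP->|]; first by rewrite subrr dot0l le_max lexx.
  rewrite ltnS => lin; rewrite le_max; apply/orP; right.
  by have := gap_ge x z lin; rewrite !dotBl; lra.
rewrite ge_max gap_ge0 /= lerBlDr.
apply: gap_le => [|i lin].
  by have := gap_ge x z (leqnSn n); have := gap_ge0 x n.+1 z; rewrite !dotBl; lra.
by have := gap_ge x z (leqW lin); rewrite !dotBl; lra.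
Qed.

Lemma suppS x n z :
  supp x n.+1 z = (gap x n z <= dot (x n.+1 - x n) z).
Proof. by rewrite /supp gapS ge_max lexx subr_le0. Qed.

Lemma gap_supp x n z : supp x n z -> gap x n.+1 z = Num.max 0 (- dot (x n.+1 - x n) z).
Proof. by move=> h; rewrite gapS (supp_gap h) sub0r. Qed.

Lemma supp_comb x n u v (a b : R) : 0 <= a -> 0 <= b ->
  supp x n u -> supp x n v -> supp x n (a *: u + b *: v).
Proof.
move=> a0 b0 /suppP hu /suppP hv; apply/suppP => i lin.
have := hu i lin; have := hv i lin.
rewrite dotDr !dotZr => hv' hu'.
by rewrite -[leRHS](addr0 0) lerD// mulr_ge0_le0.
Qed.

Lemma supp_scale x n v (a : R) : 0 < a -> supp x n (a *: v) -> supp x n v.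
Proof.
move=> a0 /suppP h; apply/suppP => i /h.
by rewrite dotZr pmulr_rle0.
Qed.

(** * Steps into the hull and rotation of the normal *)

(* Taking [b = true] accounts for a [u] parallel to some [x i - x n], which may
   lie inside the tangent cone but on the boundary of every two-point cone. *)
Definition blocked x n u : Prop := exists i j k (b : bool),
  [/\ (i <= n)%N, (j <= n)%N & (k <= n)%N] /\
  let p := x i - x n in let q := x j - x n in
  let r := u - b%:R *: (x k - x n) in
  [/\ 0 < det p q, 0 < det p r & 0 < det r q].

Definition spread x n : Prop := forall w, w != 0 ->
  exists2 i, (i <= n)%N & dot (x i - x n) w != 0.

(* A normal [w] left by the step [u] is rotated until it is orthogonal to [u];
   the last case only occurs when the hull is contained in a line. *)
Definition turn x n u w : plane :=
  if 0 <= dot u w then w else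
  if supp x n (perp u) then perp u else
  if supp x n (- perp u) then - perp u else - w.

Lemma perp_neq0 u : u != 0 -> perp u != 0.
Proof.
case: u => a b; apply: contra => /eqP[/eqP].
by rewrite oppr_eq0 => /eqP -> ->.
Qed.

(** If neither [perp u] nor [- perp u] is normal, there are hull points strictly on both sides of
    the line of [u]. Since [u] points strictly below the supporting line of [w], it then enters the
    tangent cone and is blocked, unless the hull lies on that supporting line, where [- w] is normal
    too. For [u = x n.+1 - x n] the conclusions give a common normal at [x n] and [x n.+1]. *)
Lemma turnP x n u w : w != 0 -> supp x n w -> ~ blocked x n u ->
  [/\ turn x n u w != 0, supp x n (turn x n u w) & 0 <= dot u (turn x n u w)].
Proof.
move=> w0 /suppP wn nb; rewrite /turn.
case: ifPn => [//|]; first by split => //; apply/suppP.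
rewrite -ltNge => uw.
have u0 : u != 0 by apply: contraTneq uw => ->; rewrite dot0l ltxx.
have upu : dot u (perp u) = 0 by rewrite det_perp /det; ring.
case: ifPn => [h|nh1]; first by split; rewrite ?perp_neq0// upu.
case: ifPn => [h|nh2]; first by split; rewrite ?oppr_eq0 ?perp_neq0// dotNr upu oppr0.
have [j jn hj] : exists2 j, (j <= n)%N & 0 < det u (x j - x n).
  move: nh1; rewrite -ltNge => /lt_geF h.
  apply: contrapT => hj; suff : gap x n (perp u) <= 0 by rewrite h.
  apply/suppP => i lin; rewrite det_perp leNgt; apply/negP => hi.
  by apply: hj; exists i.
have [k kn hk] : exists2 k, (k <= n)%N & det u (x k - x n) < 0.
  move: nh2; rewrite -ltNge => /lt_geF h.
  apply: contrapT => hk; suff : gap x n (- perp u) <= 0 by rewrite h.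
  apply/suppP => i lin; rewrite dotNr det_perp oppr_le0 leNgt; apply/negP => hi.
  by apply: hk; exists i.
have wj := wn j jn; have wk := wn k kn.
pose p := x k - x n; pose q := x j - x n.
(* Cramer's expansion of [u] in [p] and [q], paired with [w]. The left side is nonpositive and
   [dot u w < 0], so [det p q] is nonnegative; if it were positive, [u] would lie strictly between
   [p] and [q]. *)
have E : det u q * dot p w - det u p * dot q w = det p q * dot u w.
  by rewrite /det /dot; ring.
have pq : det p q = 0 .
  apply/eqP; rewrite eq_le; apply/andP; split; last first.
    by rewrite /p /q /det /dot in wj wk hj hk uw E *; nra.
  rewrite leNgt; apply/negP => hpq; apply: nb; exists k, j, n, false.
  split; first by split.
  rewrite scale0r subr0; split => //.
  by rewrite -/p /det in hk *; lra.
have dq : dot q w = 0.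
  by rewrite /p /q in pq E *; rewrite pq !mul0r in E; nra.
have dp : dot p w = 0.
  by rewrite /p /q in pq dq E *; rewrite pq dq !mul0r mulr0 in E; nra.
suff h : forall i, (i <= n)%N -> dot (x i - x n) w = 0.
  split; rewrite ?oppr_eq0// ?dotNr ?oppr_ge0 ?ltW//.
  by apply/suppP => i /h; rewrite dotNr => ->; rewrite oppr0.
move=> i lin; apply/eqP; rewrite eq_le wn//= leNgt; apply/negP => hi.
pose r := x i - x n; rewrite -/r in hi.
(* [p] and [q] are antiparallel and orthogonal to [w], while [r] lies strictly
   below the supporting line, so [u] is a positive combination of [r] with one
   of [p], [q], or with both when [u] is parallel to [r]. *)
have [] := ltgtP (det u r) 0 => hr.
- apply: nb; exists i, j, n, false; split; first by split.
  rewrite scale0r subr0 -/r -/q; split => //; last by rewrite /det in hr *; lra.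
  have F : det r q * dot u w = det u q * dot r w.
    transitivity (det u q * dot r w - det u r * dot q w).
      by rewrite /det /dot; ring.
    by rewrite dq mulr0 subr0.
  by rewrite -/q in hj; nra.
- apply: nb; exists k, i, n, false; split; first by split.
  rewrite scale0r subr0 -/r -/p; split => //; last by rewrite /det /p in hk *; lra.
  have F : det r p * dot u w = det u p * dot r w.
    transitivity (det u p * dot r w - det u r * dot p w).
      by rewrite /det /dot; ring.
    by rewrite dp mulr0 subr0.
  rewrite -/p in hk.
  have : det r p < 0 by nra.
  by rewrite /det; lra.
- apply: nb; exists i, j, k, true; split; first by split.
  rewrite scale1r -/r -/q -/p.
  have F : det r q * dot u w = det u q * dot r w.
    transitivity (det u q * dot r w - det u r * dot q w).
      by rewrite /det /dot; ring.
    by rewrite dq mulr0 subr0.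
  have F' : det r p * dot u w = det u p * dot r w.
    transitivity (det u p * dot r w - det u r * dot p w).
      by rewrite /det /dot; ring.
    by rewrite dp mulr0 subr0.
  rewrite -/p -/q in hk hj.
  split.
  + by nra.
  + have -> : det r (u - p) = - det u r - det r p by rewrite /det /=; ring.
    have : det r p < 0 by nra.
    by rewrite hr; lra.
  + have -> : det (u - p) q = det u q - det p q by rewrite /det /=; ring.
    by rewrite pq subr0.
Qed.


Lemma supp_colinear x n v w : v != 0 -> w != 0 -> det v w = 0 -> supp x n w ->
  supp x n v || supp x n (- v).
Proof.
move=> v0 w0 vw sw; have vv := plane_neq0 v0.
have E : dot v v *: w = dot v w *: v.
  transitivity (dot v w *: v + det v w *: perp v); last by rewrite vw scale0r addr0.
  by rewrite /det /dot; case: (v) (w) => [a b] [c d] /=;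
    rewrite ?planeZ; congr pair; rewrite /=; ring.
have [] := ltgtP (dot v w) 0 => h.
- apply/orP; right; apply: (@supp_scale _ _ _ (- dot v w)); first by rewrite oppr_gt0.
  rewrite scalerN scaleNr opprK -E -[X in supp _ _ X]addr0 -(scale0r w).
  by apply: supp_comb => //; exact: ltW.
- apply/orP; left; apply: (@supp_scale _ _ _ (dot v w)) => //.
  rewrite -E -[X in supp _ _ X]addr0 -(scale0r w).
  by apply: supp_comb => //; exact: ltW.
- move: E; rewrite h scale0r => /eqP; rewrite scaler_eq0 (negPf w0) orbF.
  by rewrite gt_eqF.
Qed.

(** Normals on opposite sides of the line of [v] would have a nonnegative combination on that line,
    making [v] or [- v] normal. The combination can vanish only for antiparallel normals, which
    force the hull into a line and contradict [spread]. *)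
Lemma sameside x n v w w' : spread x n -> ~~ supp x n v -> ~~ supp x n (- v) ->
  w' != 0 -> supp x n w -> supp x n w' -> 0 < det v w -> 0 < det v w'.
Proof.
move=> sp nv nv' w0' sw sw' vw; rewrite ltNge; apply/negP => vw'.
have E : det v w *: w' + (- det v w') *: w = det w' w *: v.
  by rewrite /det; case: (v) (w) (w') => [a b] [c d] [e f] /=;
    rewrite ?planeZ; congr pair; rewrite /=; ring.
have sc : supp x n (det w' w *: v).
  by rewrite -E; apply: supp_comb => //; [exact: ltW|rewrite oppr_ge0].
have [] := ltgtP (det w' w) 0 => h.
- move/negP: nv'; apply; apply: (@supp_scale _ _ _ (- det w' w)); first by rewrite oppr_gt0.
  by rewrite scalerN scaleNr opprK.
- by move/negP: nv; apply; exact: (@supp_scale _ _ _ (det w' w)).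
- have [i lin] := sp w' w0'; rewrite eq_le; move/suppP: (sw') => /(_ i lin) -> /=.
  move/suppP: sw => /(_ i lin) /=.
  have F : det v w * dot (x i - x n) w' = det v w' * dot (x i - x n) w.
    transitivity (dot (x i - x n) (det v w *: w' + (- det v w') *: w) + det v w' * dot (x i - x n) w).
      by rewrite dotDr !dotZr; ring.
    by rewrite E h scale0r -[X in dot _ X](scale0r v) dotZr mul0r add0r.
  move=> qw; have : 0 <= det v w * dot (x i - x n) w' by rewrite F mulr_le0.
  by rewrite pmulr_rge0// => ->.
Qed.

(** * Eight test directions *)

Definition octant : Type := (bool * bool * bool)%type.

Definition sgb (b : bool) : R := if b then 1 else -1.

Definition axisdir (o : octant) : plane :=
  if o.2 then (sgb o.1.1, 0) else (0, sgb o.1.2).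

Definition diagdir (o : octant) : plane := (sgb o.1.1, sgb o.1.2).

(* Every direction is listed twice, once for each octant it borders. *)
Definition dir (i : octant * bool) : plane :=
  if i.2 then axisdir i.1 else diagdir i.1.

Definition oct w : octant := (0 < w.1, 0 < w.2, `|w.2| < `|w.1|).

Definition oppdir (i : octant * bool) : octant * bool :=
  ((~~ i.1.1.1, ~~ i.1.1.2, i.1.2), i.2).

Lemma dir_opp i : dir (oppdir i) = - dir i.
Proof.
by move: i => [[[[] []] []] []]; congr pair; rewrite /= ?oppr0 ?opprK.
Qed.

Lemma dir_neq0 i : dir i != 0.
Proof.
apply/eqP; move: i => [[[[] []] []] []] [] /eqP; rewrite ?oppr_eq0 ?oner_eq0//=;
  by move=> _ /eqP; rewrite ?oppr_eq0 ?oner_eq0.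
Qed.

(** No test direction lies in an open octant or in its opposite, so its coordinates in the basis
    formed by the two borders never have the same strict sign. *)
Lemma dir_octant o i : exists a b, [/\ dir i = a *: axisdir o + b *: diagdir o,
  a * b <= 0 & (a != 0) || (b != 0)].
Proof.
pose a := if o.2 then sgb o.1.1 * (dir i).1 - sgb o.1.2 * (dir i).2
          else sgb o.1.2 * (dir i).2 - sgb o.1.1 * (dir i).1.
pose b := if o.2 then sgb o.1.2 * (dir i).2 else sgb o.1.1 * (dir i).1.
exists a, b; split.
- by rewrite !planeZ; move: o i @a @b => [[[] []] []] [[[[] []] []] []] /=;
    congr pair; rewrite /=; ring.
- by move: o i @a @b => [[[] []] []] [[[[] []] []] []] /=; lra.
- by move: o i @a @b => [[[] []] []] [[[[] []] []] []] /=; apply/orP;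
   (left; apply/eqP; lra) || (right; apply/eqP; lra).
Qed.

Definition good x n : bool := [exists i, supp x n (dir i)].

Lemma bad_det x n w i : ~~ good x n -> w != 0 -> supp x n w -> det (dir i) w != 0.
Proof.
move=> /existsPn bad w0 sw; apply/negP => /eqP /supp_colinear.
move=> /(_ _ _ (dir_neq0 i) w0 sw).
by rewrite -dir_opp (negPf (bad _)) (negPf (bad _)).
Qed.

Lemma bad_coords x n w : ~~ good x n -> w != 0 -> supp x n w ->
  [/\ w.1 != 0, w.2 != 0, w.1 - w.2 != 0 & w.1 + w.2 != 0].
Proof.
move=> bad w0 sw; have h i := @bad_det x n w i bad w0 sw.
have := h (true, true, false, true); have := h (true, true, true, true).
have := h (true, true, true, false); have := h (true, false, true, false).
rewrite /det /dir /axisdir /diagdir /= => h1 h2 h3 h4.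
split; [move: h4|move: h3|move: h2|move: h1]; apply: contra => /eqP e; apply/eqP; lra.
Qed.

Lemma octP w : w.1 != 0 -> w.2 != 0 -> w.1 - w.2 != 0 -> w.1 + w.2 != 0 ->
  exists a b, [/\ 0 < a, 0 < b & w = a *: axisdir (oct w) + b *: diagdir (oct w)].
Proof.
case: w => a b /= a0 b0 ab0 ab1.
exists (if `|b| < `|a| then `|a| - `|b| else `|b| - `|a|).
exists (if `|b| < `|a| then `|b| else `|a|).
have := a0; have := b0; rewrite !neq_lt => /orP b00 /orP a00.
have nab : `|b| != `|a|.
  rewrite eqr_norm2 negb_or; apply/andP; split; apply/negP => /eqP e.
    by rewrite e subrr eqxx in ab0.
  by rewrite e subrr eqxx in ab1.
have := nab; rewrite neq_lt => /orP nab'.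
split.
- by case: ltP nab'; rewrite !subr_gt0// => ba []// /lt_geF; rewrite ba.
- by case: ifP; rewrite normr_gt0.
- rewrite /oct /axisdir /diagdir /=; case: ltP => _ /=;
  case: a00 => a0'; case: b00 => b0' ;
  rewrite ?(ltr0_norm a0') ?(gtr0_norm a0') ?(ltr0_norm b0') ?(gtr0_norm b0');
  rewrite ?a0' ?b0' ?(lt_gtF a0') ?(lt_gtF b0');
  by rewrite ?planeZ; congr pair; rewrite /=; ring.
Qed.

Lemma bad_octP x n w : ~~ good x n -> w != 0 -> supp x n w ->
  exists a b, [/\ 0 < a, 0 < b & w = a *: axisdir (oct w) + b *: diagdir (oct w)].
Proof. by move=> bad w0 sw; have [? ? ? ?] := bad_coords bad w0 sw; exact: octP. Qed.

(** The octant can be read off from the signs of the determinants with four test directions, and by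
    [sameside] no such sign differs between two normals. *)
Lemma bad_oct_eq x n w w' : spread x n -> ~~ good x n -> w != 0 -> w' != 0 ->
  supp x n w -> supp x n w' -> oct w = oct w'.
Proof.
move=> sp bad w0 w0' sw sw'.
have nbad i : ~~ supp x n (dir i) by move/existsPn: bad.
have h i : (0 < det (dir i) w) = (0 < det (dir i) w').
  by apply/idP/idP; apply: (@sameside x n) => //; rewrite ?nbad// -dir_opp nbad.
(* The comparison means [z.1 ^+ 2 - z.2 ^+ 2 > 0], that is, both factors have the same sign. *)
have E (z : plane) : z.1 - z.2 != 0 -> z.1 + z.2 != 0 ->
    (`|z.2| < `|z.1|) = ((0 < z.1 - z.2) == (0 < z.1 + z.2)).
  case: z => a b /=; rewrite !neq_lt => /orP[] p /orP[] q;
  rewrite ?p ?q ?(lt_gtF p) ?(lt_gtF q) ?eqxx.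
  - have a0 : a < 0 by lra.
    have h' : - - a < b < - a by apply/andP; split; lra.
    by rewrite (ltr0_norm a0) ltr_norml h'.
  - have b0 : 0 < b by lra.
    have h' : - b <= a <= b by apply/andP; split; lra.
    by apply/negbTE; rewrite -leNgt (gtr0_norm b0) ler_norml h'.
  - have b0 : b < 0 by lra.
    have h' : - - b <= a <= - b by apply/andP; split; lra.
    by apply/negbTE; rewrite -leNgt (ltr0_norm b0) ler_norml h'.
  - have a0 : 0 < a by lra.
    have h' : - a < b < a by apply/andP; split; lra.
    by rewrite (gtr0_norm a0) ltr_norml h'.
have [_ _ a3 a4] := bad_coords bad w0 sw.
have [_ _ b3 b4] := bad_coords bad w0' sw'.
rewrite /oct !E//.
have := h (true, true, true, true); have := h (true, false, false, true).
have := h (false, false, true, false); have := h (true, false, true, false).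
rewrite /det /dir /axisdir /diagdir /=.
rewrite !mul0r !mul1r !mulN1r !sub0r !subr0 !opprK => h1 h2 h3 h4.
rewrite h3 h4 -(addrC w.2) h1 [w.1 - _]addrC h2 [_ + w'.1]addrC [w'.2 + _]addrC.
by [].
Qed.

End Plane.

Section Drift.
Context {R : realType}.
Local Notation plane := (R * R)%type.
Implicit Types (u v w z : plane) (x : nat -> plane) (i : octant * bool).

(** The normal cone is convex. Moving inside it from [w], which lies in the open octant, towards
    [dir i], which does not, crosses one of the two borders; the crossing point is written down
    explicitly. *)
Lemma octant_entry x n w i (a b : R) : 0 < a -> 0 < b ->
  w = a *: axisdir (oct w) + b *: diagdir (oct w) ->
  supp x n w -> supp x n (dir i) ->
  supp x n (axisdir (oct w)) || supp x n (diagdir (oct w)).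
Proof.
set e := axisdir _; set d := diagdir _ => a0 b0 wE sw si.
have [p [q [iE pq pq0]]] := dir_octant (R := R) (oct w) i; rewrite -/e -/d in iE.
have [pqd|pqd] : (p <= 0 /\ 0 <= q) \/ (0 <= p /\ q <= 0).
- have [p0|p0] := lerP p 0; last by right; split; [exact: ltW|rewrite pmulr_rle0 in pq].
  have [q0|q0] := lerP 0 q; first by left.
  by right; split; [rewrite nmulr_lle0 in pq|exact: ltW].
- have c0 : 0 < a * q - b * p.
    move: pqd pq0 => [p0 q0]; rewrite !neq_lt => /orP[] /orP[] h; nra.
  apply/orP; right; apply: (supp_scale c0).
  have -> : (a * q - b * p) *: d = (- p) *: w + a *: dir i :> plane.
    by rewrite {1}wE iE !planeZ; congr pair; rewrite /=; ring.
  by apply: supp_comb => //; [rewrite oppr_ge0; case: pqd|exact: ltW].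
- have c0 : 0 < b * p - a * q.
    move: pqd pq0 => [p0 q0]; rewrite !neq_lt => /orP[] /orP[] h; nra.
  apply/orP; left; apply: (supp_scale c0).
  have -> : (b * p - a * q) *: e = (- q) *: w + b *: dir i :> plane.
    by rewrite {1}wE iE !planeZ; congr pair; rewrite /=; ring.
  by apply: supp_comb => //; [rewrite oppr_ge0; case: pqd|exact: ltW].
Qed.

(** * Drift of the potential *)

(** The support function [max_(i <= n) dot (x i) v] of the hull, written through [gap] so that an
    increment along [v] splits into growth of the height and decrease of the gap. *)
Definition height x n v : R := gap x n v + dot (x n) v.

Definition heights x n : R := \sum_i height x n (dir i).

Definition deficit x n w : R :=
  if good x n then 0
  else Num.min (gap x n (axisdir (oct w))) (gap x n (diagdir (oct w))).

(** What a unit step gains along [dir i] when it makes an angle of at most [pi / 4] with it: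
    [cos (pi / 4)] rounded down for the axes, and [1] for the diagonals, which have norm
    [sqrt 2]. *)
Definition thr (i : octant * bool) : R := if i.2 then 7 / 10 else 1.

(** The norm of [dir i], with [sqrt 2] rounded up. *)
Definition bnd (i : octant * bool) : R := if i.2 then 1 else 3 / 2.

Definition anchor x n w i : bool :=
  ~~ good x n && (i == (oct w, gap x n (axisdir (oct w)) <= gap x n (diagdir (oct w)))).

(* Pathwise lower bound for the increment of [20 * heights - deficit]: only the
   events [thr i <= _] and [_ < 0] enter, so its conditional mean is controlled
   by arc lengths of half-planes. *)
Definition gain x n w : R := \sum_i
  ((supp x n (dir i))%:R * (20 * (thr i * (thr i <= dot (x n.+1 - x n) (dir i))%R%:R) - 2)
   + (anchor x n w i)%:R * (thr i * (thr i <= dot (x n.+1 - x n) (dir i))%R%:R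
                          - bnd i * (dot (x n.+1 - x n) (dir i) < 0)%R%:R)).

Lemma heightS x n v :
  height x n.+1 v = Num.max (dot (x n.+1 - x n) v) (gap x n v) + dot (x n) v.
Proof.
rewrite /height gapS !maxEle dotBl.
by case: ifPn => h1; case: ifPn => h2; lra.
Qed.

Lemma height_homo x n v : height x n v <= height x n.+1 v.
Proof. by rewrite heightS lerD2r le_max lexx orbT. Qed.

(** The vector [w'] is normal at both times. If a test direction is normal at [x n], its [- 2] pays
    for a new deficit: a border of the octant entered was normal one step before, so its gap is at
    most [bnd <= 2]. Otherwise the octant persists by [bad_oct_eq]; the anchored gap then decreases
    by the increment along the anchor minus the growth of its height, and the height term absorbs
    the latter. *)
Lemma gainP x n w w' : spread x n -> w != 0 -> w' != 0 ->
  supp x n w -> supp x n w' -> supp x n.+1 w' ->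
  (forall i, dot (x n.+1 - x n) (dir i) <= bnd i) ->
  gain x n w <= 20 * (heights x n.+1 - heights x n) - (deficit x n.+1 w' - deficit x n w).
Proof.
move=> sp w0 w0' sw sw' sw1; set u := x n.+1 - x n => ub.
have ubN i : - dot u (dir i) <= bnd i by rewrite -dotNr -dir_opp ub.
have bnd2 i : bnd i <= 2 by rewrite /bnd; case: i.2; lra.
have hS i : 0 <= height x n.+1 (dir i) - height x n (dir i) by rewrite subr_ge0 height_homo.
rewrite /gain /heights -sumrB -/u.
have [gd|bad] := boolP (good x n).
- rewrite {2}/deficit gd subr0.
  have -> : \sum_i ((supp x n (dir i))%:R * (20 * (thr i * (thr i <= dot u (dir i))%R%:R) - 2)
   + (anchor x n w i)%:R * (thr i * (thr i <= dot u (dir i))%R%:R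
        - bnd i * (dot u (dir i) < 0)%R%:R)) =
    20 * (\sum_i (supp x n (dir i))%:R * (thr i * (thr i <= dot u (dir i))%R%:R))
    - 2 * \sum_i (supp x n (dir i))%:R :> R.
    rewrite !mulr_sumr -sumrB; apply: eq_bigr => i _.
    by rewrite /anchor gd /=; ring.
  apply: lerB.
    rewrite ler_pM2l//; apply: ler_sum => i _.
    have [si|] := boolP (supp x n (dir i)); last by rewrite mul0r.
    rewrite mul1r heightS /height -/u (supp_gap si) add0r addrK.
    by case: (leP (thr i)) => h; rewrite ?mulr1 ?mulr0 le_max ?h ?lexx ?orbT.
  have [j sj] := existsP gd.
  have s1 : 1 <= \sum_i (supp x n (dir i))%:R :> R.
    by rewrite (bigD1 j)//= sj lerDl sumr_ge0.
  suff : deficit x n.+1 w' <= 2 by lra.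
  rewrite /deficit; case: ifPn => // bad'.
  have [a [b [a0 b0 wE]]] := bad_octP bad' w0' sw1.
  have gz (k : octant * bool) : supp x n (dir k) -> gap x n.+1 (dir k) <= 2.
    by move=> sk; rewrite (gap_supp sk) ge_max (le_trans (ubN k))// andbT.
  have := octant_entry a0 b0 wE sw' sj; rewrite ge_min => /orP[] s.
    by rewrite (gz (oct w', true)).
  by rewrite (gz (oct w', false))// orbT.
- have ns i : supp x n (dir i) = false by apply/negbTE; move/existsPn: bad.
  pose j := (oct w, gap x n (axisdir (oct w)) <= gap x n (diagdir (oct w))).
  rewrite (bigD1 j)//= [X in _ + X]big1 => [|i ij]; last first.
    by rewrite /anchor -/j (negPf ij) andbF ns !mul0r addr0.
  rewrite /anchor -/j bad eqxx ns mul0r mul1r add0r addr0.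
  have dE : deficit x n w = gap x n (dir j).
    rewrite /deficit (negPf bad) minEle /dir /j /=.
    by case: ifP.
  have le' : deficit x n.+1 w' <= gap x n.+1 (dir j).
    rewrite /deficit; case: ifPn => _; first exact: gap_ge0.
    rewrite -(bad_oct_eq sp bad w0 w0' sw sw') ge_min /dir /j /=.
    by case: ifP => _; rewrite lexx ?orbT.
  have hj : height x n.+1 (dir j) - height x n (dir j) <=
      \sum_i (height x n.+1 (dir i) - height x n (dir i)).
    by rewrite (bigD1 j)//= lerDl sumr_ge0.
  have := hS j; move: hj le'; rewrite dE /height dotBl => hj le' hj0.
  suff : thr j * (thr j <= dot u (dir j))%R%:R - bnd j * (dot u (dir j) < 0)%R%:R <= dot u (dir j).
    by rewrite {3}/u dotBl; lra.
  have := ubN j.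
  have : 0 < thr j :> R by rewrite /thr; case: j.2; lra.
  move=> t0 uj; case: (leP (thr j) (dot u (dir j))) => h;
    case: (ltP (dot u (dir j)) 0) => h' /=;
    rewrite ?mulr1n ?mulr0n ?mulr1 ?mulr0; lra.
Qed.

End Drift.

(** * Allowed steps *)

Section Hull.
Local Open Scope convex_scope.
Context {R : realType}.
Local Notation plane := (R * R)%type.
Implicit Types (u v w z : plane) (x : nat -> plane).

Lemma hull_point x n i : (i <= n)%N -> hull_upto x n (x i).
Proof.
move=> lin M [_ sM]; apply: sM; exists i => //=.
Qed.

Lemma hull_conv x n u v (t : R) : 0 <= t -> t <= 1 ->
  hull_upto x n u -> hull_upto x n v -> hull_upto x n (t *: u + (1 - t) *: v).
Proof.
move=> t0 t1 hu hv M [cM sM].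
have := cM u v (Itv01 t0 t1); rewrite !inE; apply.
- by apply: hu; split.
- by apply: hv; split.
Qed.

Lemma hull_half_plane x n w : supp x n w ->
  hull_upto x n `<=` [set y | dot (y - x n) w <= 0].
Proof.
move=> /suppP sw; apply: smallest_sub; last first.
  by move=> _ [i /= lin <-]; exact: sw.
move=> a b l; rewrite !inE /= => ha hb.
have -> : a <| l |> b = l%:num *: (a : plane) + (1 - l%:num) *: (b : plane) by [].
have -> : dot (l%:num *: (a : plane) + (1 - l%:num) *: (b : plane) - x n) w =
   l%:num * dot ((a : plane) - x n) w + (1 - l%:num) * dot ((b : plane) - x n) w.
  by rewrite !dotBl dotDl !dotZl; ring.
have l0 : 0 <= l%:num by [].
have l1 : l%:num <= 1 by [].
by nra.
Qed.

Lemma planeball (u v : plane) (e : R) :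
  `|u.1 - v.1| < e -> `|u.2 - v.2| < e -> ball u e v.
Proof. by move=> h1 h2; split; rewrite /ball /=. Qed.

(** From an interior point a small move along [w] stays in the hull, so the inequality of
    [hull_half_plane] becomes strict. *)
Lemma interior_half_plane x n w : w != 0 -> supp x n w ->
  interior (hull_upto x n) `<=` [set y | dot (y - x n) w < 0].
Proof.
move=> w0 sw y /nbhs_ballP [e /= e0 he] /=.
have ww := plane_neq0 w0.
pose k := e / (2 * (`|w.1| + `|w.2| + 1)).
have a1 : 0 <= `|w.1| := normr_ge0 _.
have a2 : 0 <= `|w.2| := normr_ge0 _.
have k0 : 0 < k by rewrite divr_gt0//; lra.
have kE : k * (`|w.1| + `|w.2| + 1) = e / 2 by rewrite /k; field; lra.
have : hull_upto x n (y + k *: w).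
  apply: he; apply: planeball; rewrite /= opprD addrA subrr sub0r normrN normrM (gtr0_norm k0); nra.
move=> /(hull_half_plane sw) /=.
rewrite -addrAC dotDl dotZl.
by have := mulr_gt0 k0 ww; lra.
Qed.

Lemma allowed_half_plane x n w u : w != 0 -> supp x n w ->
  enorm u = 1 -> 0 <= dot u w -> allowed x n (x n + u).
Proof.
move=> w0 sw u1 uw; split; first by rewrite addrAC subrr add0r.
rewrite -subset0 => y [[t /=]]; rewrite in_itv/= => /andP[t0 t1] <-.
move=> /(interior_half_plane w0 sw) /=.
have -> : (1 - t) *: x n + t *: (x n + u) - x n = t *: u.
  by rewrite !planeZ; congr pair; rewrite /=; ring.
by rewrite dotZl ltNge mulr_ge0.
Qed.

Lemma hull_ray x n v (t : R) : 0 <= t -> t <= 1 ->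
  hull_upto x n (x n + v) -> hull_upto x n (x n + t *: v).
Proof.
move=> t0 t1 h.
have -> : x n + t *: v = t *: (x n + v) + (1 - t) *: x n.
  by rewrite !planeZ; congr pair; rewrite /=; ring.
by apply: hull_conv => //; exact: hull_point.
Qed.

Lemma hull_mid x n u v : hull_upto x n (x n + u) -> hull_upto x n (x n + v) ->
  hull_upto x n (x n + 2^-1 *: (u + v)).
Proof.
move=> hu hv.
have -> : x n + 2^-1 *: (u + v) = 2^-1 *: (x n + u) + (1 - 2^-1) *: (x n + v) :> plane.
  by rewrite !planeZ; congr pair; rewrite /=; field.
by apply: hull_conv => //; lra.
Qed.

(** Two nested midpoints multiply the last two coefficients by [4], whence the bound [1 / 4] that
    keeps every rescaled point in the hull. *)
Lemma hull_cone3 x n i j k (a b c : R) : (i <= n)%N -> (j <= n)%N -> (k <= n)%N ->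
  0 <= a <= 1 / 4 -> 0 <= b <= 1 / 4 -> 0 <= c <= 1 / 4 ->
  hull_upto x n (x n + (a *: (x i - x n) + b *: (x j - x n) + c *: (x k - x n))).
Proof.
move=> hi hj hk /andP[a0 a1] /andP[b0 b1] /andP[c0 c1].
have h l : (l <= n)%N -> hull_upto x n (x n + (x l - x n)).
  by move=> ln; rewrite addrC subrK; exact: hull_point.
have -> : a *: (x i - x n) + b *: (x j - x n) + c *: (x k - x n) =
   2^-1 *: ((2 * a) *: (x i - x n)
    + 2^-1 *: ((4 * b) *: (x j - x n) + (4 * c) *: (x k - x n))) :> plane.
  by rewrite !planeZ; congr pair; rewrite /=; field.
apply: hull_mid; first by apply: hull_ray; [lra|lra|exact: h].
by apply: hull_mid; apply: hull_ray; (lra || exact: h).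
Qed.

(** A small multiple of [u] has positive coefficients along the independent vectors [p] and [q].
    Perturbing these two coefficients fills a neighbourhood inside the hull, so the segment meets
    the interior. *)
Lemma blocked_allowed x n u : blocked x n u -> ~ allowed x n (x n + u).
Proof.
move=> [i [j [k [b [[hi hj hk]]]]]] /=.
set p := x i - x n; set q := x j - x n; set s := x k - x n; set r := u - _.
move=> [pq pr rq] [_] /seteqP [/(_ _) h _].
pose D := det p q; pose l := det r q / D; pose m := det p r / D.
have D0 : 0 < D by [].
have l0 : 0 < l by rewrite divr_gt0.
have m0 : 0 < m by rewrite divr_gt0.
have uE : u = l *: p + m *: q + b%:R *: s.
  have -> : l *: p + m *: q = r.
    rewrite /l /m /D !planeZ; move: D0; rewrite /D /det.
    case: (p) (q) (r) => [? ?] [? ?] [? ?] /= D0.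
    by congr pair; rewrite /=; field; rewrite gt_eqF.
  by rewrite subrK.
(* This makes all three coefficients of [e *: u] at most [1 / 8], half of what [hull_cone3]
   accepts. *)
pose e := (8 * (l + m + 1))^-1.
have e0 : 0 < e by rewrite invr_gt0; lra.
have eE : e * (l + m + 1) = 1 / 8 by rewrite /e; field; lra.
have b0 : 0 <= b%:R :> R by [].
have b1 : b%:R <= 1 :> R by rewrite lern1 leq_b1.
have e1 : e <= 1 by nra.
apply: (h (x n + e *: u)); split.
  exists e; first by rewrite /= in_itv /= e1 ltW.
  by rewrite !planeZ; congr pair; rewrite /=; ring.
apply/nbhs_ballP.
pose W := `|p.1| + `|p.2| + `|q.1| + `|q.2| + 1.
have n1 := normr_ge0 p.1; have n2 := normr_ge0 p.2.
have n3 := normr_ge0 q.1; have n4 := normr_ge0 q.2.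
(* A perturbation of size [M] keeps the coefficients of [p] and [q] nonnegative and at most [1 / 4].
   The radius [D * M / W] below comes from bounding the numerators in Cramer's rule. *)
pose M := Num.min (e * l) (Num.min (e * m) (1 / 8)).
have M0 : 0 < M by rewrite /M !lt_min (mulr_gt0 e0 l0) (mulr_gt0 e0 m0) divr_gt0.
have W1 : 1 <= W by rewrite /W; lra.
have d0 : 0 < D * M / W by rewrite !divr_gt0// ?mulr_gt0//; lra.
exists (D * M / W) => //= y [/= y1 y2].
pose dy := y - (x n + e *: u).
have by1 : `|dy.1| < D * M / W by move: y1; rewrite /ball /= distrC.
have by2 : `|dy.2| < D * M / W by move: y2; rewrite /ball /= distrC.
have bound (z : plane) : `|z.1| + `|z.2| <= W -> `|det dy z| <= D * M.
  move=> hz.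
  have -> : D * M = D * M / W * W by field; lra.
  rewrite /det (le_trans (ler_normB _ _))// !normrM.
  have := normr_ge0 z.1; have := normr_ge0 z.2.
  by nra.
have bl : `|det dy q / D| <= M.
  rewrite normrM normfV (gtr0_norm D0) ler_pdivrMr// mulrC.
  by apply: bound; rewrite /W; lra.
have bm : `|det p dy / D| <= M.
  rewrite normrM normfV (gtr0_norm D0) ler_pdivrMr// mulrC.
  have -> : det p dy = - det dy p by rewrite /det; ring.
  by rewrite normrN; apply: bound; rewrite /W; lra.
have yE : y = x n + ((e * l + det dy q / D) *: p + (e * m + det p dy / D) *: q
   + (e * b%:R) *: s).
  have F : dy = (det dy q / D) *: p + (det p dy / D) *: q.
    rewrite /D !planeZ; move: D0; rewrite /D /det.
    case: (p) (q) (dy) => [? ?] [? ?] [? ?] /= D0.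
    by congr pair; rewrite /=; field; rewrite gt_eqF.
  have -> : y = x n + e *: u + dy by rewrite /dy addrC subrK.
  rewrite {1}F uE.
  by rewrite !planeZ; congr pair; rewrite /=; ring.
have Ml : M <= e * l by rewrite /M ge_min lexx.
have Mm : M <= e * m by rewrite /M !ge_min lexx orbT.
have M8 : M <= 1 / 8 by rewrite /M !ge_min lexx !orbT.
move: bl bm; rewrite !ler_norml => /andP[bl1 bl2] /andP[bm1 bm2].
rewrite yE; apply: hull_cone3 => //; apply/andP; split; nra.
Qed.

End Hull.

(** * Arc lengths of octants *)

Section Arcs.
Context {R : realType}.
Local Notation plane := (R * R)%type.
Implicit Types (u v w p : plane) (x : nat -> plane) (o : octant) (i : octant * bool).

Definition inoct o u : bool :=
  if o.2 then 0 <= sgb o.1.2 * u.2 <= sgb o.1.1 * u.1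
  else 0 <= sgb o.1.1 * u.1 <= sgb o.1.2 * u.2.

(** Rank of the octant in counterclockwise order from the positive first axis; the half-open arcs
    [octarc] then partition [[0, 2 pi[]. *)
Definition octpos o : nat :=
  match o with
  | (true, true, true) => 0 | (true, true, false) => 1
  | (false, true, false) => 2 | (false, true, true) => 3
  | (false, false, true) => 4 | (false, false, false) => 5
  | (true, false, false) => 6 | (true, false, true) => 7
  end.

Definition octarc o : set R :=
  `[(octpos o)%:R * (pi / 4), ((octpos o).+1)%:R * (pi / 4)[%classic.

(* The two octants bordering the direction [dir i]. *)
Definition nearoct i (b : bool) : octant :=
  if i.2 then (if i.1.2 then (i.1.1.1, b, true) else (b, i.1.1.2, false))
  else (i.1.1, b).

(* The only octant of steps that decrease along [dir i] and yet increase along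
   the other direction bordering the octant [i.1]. *)
Definition backoct i : octant :=
  if i.2 == i.1.2 then (~~ i.1.1.1, i.1.1.2, ~~ i.2) else (i.1.1.1, ~~ i.1.1.2, i.2).

Definition unitv (t : R) : plane := (cos t, sin t).

Lemma enorm_unitv t : enorm (unitv t) = 1.
Proof. by rewrite /enorm /= cos2Dsin2 sqrtr1. Qed.

Lemma enorm_sqr u : enorm u = 1 -> u.1 ^+ 2 + u.2 ^+ 2 = 1.
Proof.
move=> h; rewrite -(sqr_sqrtr (_ : 0 <= u.1 ^+ 2 + u.2 ^+ 2)).
  by rewrite -/(enorm u) h expr1n.
by rewrite addr_ge0 ?sqr_ge0.
Qed.

Lemma unitv0 (t : R) : 0 <= t -> t <= pi / 4 -> 0 <= sin t <= cos t.
Proof.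
move=> t0 t1; have p0 := @pi_gt0 R.
rewrite sin_ge0_pi/=; last by apply/andP; split; lra.
rewrite -cosBpihalf -cosN opprB leNgt ltr_cos ?in_itv/=; [|apply/andP; split; lra..].
by rewrite -leNgt; lra.
Qed.

Lemma unitv1 (t : R) : pi / 4 <= t -> t <= pi / 2 -> 0 <= cos t <= sin t.
Proof.
move=> t0 t1; have p0 := @pi_gt0 R.
have /andP[] : 0 <= sin (pi / 2 - t) <= cos (pi / 2 - t) by apply: unitv0; lra.
by rewrite -opprB sinN cosN sinBpihalf cosBpihalf opprK => -> ->.
Qed.

Lemma inoct_unitv o t : octarc o t -> inoct o (unitv t).
Proof.
rewrite /octarc /= in_itv /= => /andP[h1 h2]; have p0 := @pi_gt0 R.
have q1 (s : R) : 0 <= s -> s <= pi / 4 -> 0 <= sin s <= cos s := @unitv0 s.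
have q2 (s : R) : pi / 4 <= s -> s <= pi / 2 -> 0 <= cos s <= sin s := @unitv1 s.
(* [E1] to [E6] describe rotations by one, two and three quarter turns, which reduce every octant to
   the first quadrant. *)
have E1 : cos t = - sin (t - pi / 2) by rewrite sinBpihalf opprK.
have E2 : sin t = cos (t - pi / 2) by rewrite cosBpihalf.
have E3 : cos t = - cos (t - pi) by rewrite -(cosDpi (t - pi)) subrK.
have E4 : sin t = - sin (t - pi) by rewrite -(sinDpi (t - pi)) subrK.
have E5 : cos t = sin (t - pi - pi / 2) by rewrite sinBpihalf -E3.
have E6 : sin t = - cos (t - pi - pi / 2) by rewrite cosBpihalf -E4.
move: o h1 h2 => [[[] []] []] /= h1 h2; rewrite /inoct /unitv /= ?mul1r ?mulN1r.
- by apply: q1; lra.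
- by apply: q2; lra.
- by rewrite E5 E6 !opprK; apply: q2; lra.
- by rewrite E5 E6 !opprK; apply: q1; lra.
- by rewrite E1 E2 !opprK; apply: q2; lra.
- by rewrite E1 E2 !opprK; apply: q1; lra.
- by rewrite E3 E4 !opprK; apply: q1; lra.
- by rewrite E3 E4 !opprK; apply: q2; lra.
Qed.

Lemma octarc_cover (t : R) : 0 <= t -> t < 2 * pi -> exists o, octarc o t.
Proof.
move=> t0 t1; have p0 := @pi_gt0 R.
suff : exists o, (octpos o)%:R * (pi / 4) <= t < ((octpos o).+1)%:R * (pi / 4).
  by case=> k h; exists k; rewrite /octarc /= in_itv.
have [h1|h1] := ltP t (1 * (pi / 4)); first by exists (true, true, true); apply/andP; split => /=; lra.
have [h2|h2] := ltP t (2 * (pi / 4)); first by exists (true, true, false); apply/andP; split => /=; lra.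
have [h3|h3] := ltP t (3 * (pi / 4)); first by exists (false, true, false); apply/andP; split => /=; lra.
have [h4|h4] := ltP t (4 * (pi / 4)); first by exists (false, true, true); apply/andP; split => /=; lra.
have [h5|h5] := ltP t (5 * (pi / 4)); first by exists (false, false, true); apply/andP; split => /=; lra.
have [h6|h6] := ltP t (6 * (pi / 4)); first by exists (false, false, false); apply/andP; split => /=; lra.
have [h7|h7] := ltP t (7 * (pi / 4)); first by exists (true, false, false); apply/andP; split => /=; lra.
by exists (true, false, true); apply/andP; split => /=; lra.
Qed.

(** Such a [u] is within [pi / 4] of [dir i], and the other border of the octant [i.1] is at angle
    [pi / 4] from [dir i], so neither angle exceeds a right angle. *)
Lemma nearoct_ge0 i b u : inoct (nearoct i b) u ->
  0 <= dot u (axisdir i.1) /\ 0 <= dot u (diagdir i.1).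
Proof.
rewrite /inoct /dot /axisdir /diagdir.
by move: i b => [[[[] []] []] []] [] /= /andP[h1 h2]; split; lra.
Qed.

Lemma unit_octant_bounds (a b : R) : 0 <= b -> b <= a -> a ^+ 2 + b ^+ 2 = 1 ->
  7 / 10 <= a /\ 1 <= a + b.
Proof.
move=> b0 ba h; split; rewrite leNgt; apply/negP => c.
  have : a * a < 7 / 10 * (7 / 10) by nra.
  have : b * b <= a * a by nra.
  by move: h; rewrite !expr2; lra.
have : (a + b) * (a + b) < 1 by nra.
by have := mulr_ge0 (le_trans b0 ba) b0; move: h; rewrite !expr2; lra.
Qed.

Lemma nearoct_thr i b u : enorm u = 1 -> inoct (nearoct i b) u ->
  thr i <= dot u (dir i).
Proof.
move=> /enorm_sqr h; rewrite /inoct => hb.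
rewrite /dot /dir /axisdir /diagdir /thr.
by move: i b hb => [[[[] []] []] []] [] /= /andP[h3 h4];
  (have [|p q] := unit_octant_bounds h3 h4; first by lra); lra.
Qed.

Lemma backoctP i o u : dot u (dir i) < 0 -> 0 < dot u (dir (i.1, ~~ i.2)) ->
  inoct o u -> o = backoct i.
Proof.
rewrite /inoct /dot /dir /axisdir /diagdir.
by move: i o => [[[[] []] []] []] [[[] []] []] //= h1 h2 /andP[h3 h4]; exfalso; lra.
Qed.

Lemma unit_bnd i u : enorm u = 1 -> dot u (dir i) <= bnd i.
Proof.
move=> /enorm_sqr; rewrite /dot /dir /axisdir /diagdir /bnd.
have := sqr_ge0 (u.1 - 1); have := sqr_ge0 (u.1 + 1).
have := sqr_ge0 (u.2 - 1); have := sqr_ge0 (u.2 + 1); have := sqr_ge0 u.1; have := sqr_ge0 u.2.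
by move: i => [[[[] []] []] []] /=; lra.
Qed.

(** The measure unfolds to an outer measure, which is monotone on arbitrary sets; this is how arcs
    cut out by [allowed] are compared. *)
Lemma leb_le (A B : set R) : A `<=` B -> (lebesgue_measure A <= lebesgue_measure B)%E.
Proof.
move=> AB; rewrite /lebesgue_measure /lebesgue_stieltjes_measure /measure_extension.
exact: le_outer_measure.
Qed.

Lemma leb_octarc o : (lebesgue_measure (octarc o) = (pi / 4)%:E)%E.
Proof.
have p0 := @pi_gt0 R.
rewrite /octarc lebesgue_measure_itv /= lte_fin ltr_pM2r ?ltr_nat ?ltnSn; last by lra.
by rewrite -EFinB; congr EFin; rewrite -[_.+1]addn1 natrD; ring.
Qed.

Lemma octarc_disj o o' : o != o' -> octarc o `&` octarc o' = set0.
Proof.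
move=> oo'; rewrite -subset0 => t [] /=; rewrite /octarc /= !in_itv /= => /andP[h1 h2] /andP[h3 h4].
have p0 : 0 < pi / 4 :> R by have := @pi_gt0 R; lra.
have l1 : (octpos o < (octpos o').+1)%N.
  by rewrite -(ltr_nat R) -(ltr_pM2r p0) (le_lt_trans h1).
have l2 : (octpos o' < (octpos o).+1)%N.
  by rewrite -(ltr_nat R) -(ltr_pM2r p0) (le_lt_trans h3).
have /eqP e : octpos o == octpos o' by rewrite eqn_leq -ltnS l1 -ltnS l2.
by move: oo' e; move: o o' {h1 h2 h3 h4 l1 l2} => [[[] []] []] [[[] []] []].
Qed.

Lemma arc_length_ge0 p B : (0 <= arc_length p B)%E.
Proof. exact: measure_ge0. Qed.

Lemma arc_length_le p A B : (forall u, enorm u = 1 -> A (p + u) -> B (p + u)) ->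
  (arc_length p A <= arc_length p B)%E.
Proof.
move=> AB; apply: leb_le => t [tI At]; split => //=.
by apply: AB At; exact: enorm_unitv.
Qed.

Lemma arc_length_le2pi p B : (arc_length p B <= (2 * pi)%:E)%E.
Proof.
have p0 := @pi_gt0 R.
apply: (@le_trans _ _ (lebesgue_measure `[0, 2 * pi[%classic)).
  by apply: leb_le => t [].
by rewrite lebesgue_measure_itv /= lte_fin mulr_gt0// -EFinB subr0.
Qed.

Lemma arc_length_fin p B : (arc_length p B \is a fin_num)%E.
Proof.
by rewrite ge0_fin_numE ?arc_length_ge0// (le_lt_trans (arc_length_le2pi p B))// ltry.
Qed.

Lemma octarc_sub o t : octarc o t -> 0 <= t < 2 * pi.
Proof.
rewrite /octarc /= in_itv /= => /andP[h1 h2]; have p0 := @pi_gt0 R.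
have p4 : 0 <= pi / 4 :> R by lra.
apply/andP; split; first by apply: le_trans h1; rewrite mulr_ge0.
apply: (lt_le_trans h2); have -> : 2 * pi = 8%:R * (pi / 4) :> R by field.
by rewrite ler_wpM2r// ler_nat; move: o {h1 h2} => [[[] []] []].
Qed.

Lemma arc_length_near p B i :
  (forall b u, enorm u = 1 -> inoct (nearoct i b) u -> B (p + u)) ->
  ((pi / 2)%:E <= arc_length p B)%E.
Proof.
move=> h.
have E : (lebesgue_measure (octarc (nearoct i true) `|` octarc (nearoct i false)) =
    lebesgue_measure (octarc (nearoct i true)) + lebesgue_measure (octarc (nearoct i false)))%E.
  apply: measureU; [exact: measurable_itv..|].
  by apply: octarc_disj; move: i {h} => [[[[] []] []] []].
have -> : (pi / 2)%:E = lebesgue_measure (octarc (nearoct i true) `|` octarc (nearoct i false)).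
  by rewrite E !leb_octarc -EFinD; congr EFin; field.
apply: leb_le => t.
have H b : octarc (nearoct i b) t -> B (p + unitv t) /\ 0 <= t < 2 * pi.
  by move=> ht; split; [apply: (h b); [exact: enorm_unitv|exact: inoct_unitv]|exact: octarc_sub ht].
by move=> [] /H [Bt tI]; split => //=; rewrite in_itv.
Qed.

Lemma arc_length_back p B o :
  (forall o' u, enorm u = 1 -> B (p + u) -> inoct o' u -> o' = o) ->
  (arc_length p B <= (pi / 4)%:E)%E.
Proof.
move=> h; rewrite -(leb_octarc o); apply: leb_le => t [/=].
rewrite in_itv /= => /andP[t0 t1] Bt.
have [k ho'] := octarc_cover t0 t1.
by rewrite -(h k (unitv t) (enorm_unitv t) Bt (inoct_unitv ho')).
Qed.

End Arcs.

Section Law.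
Context {R : realType}.
Local Notation plane := (R * R)%type.
Implicit Types (u v w p : plane) (x : nat -> plane) (o : octant) (i : octant * bool).

Lemma step_law_ge0 x n B : 0 <= step_law x n B.
Proof. by rewrite divr_ge0// fine_ge0// arc_length_ge0. Qed.

Lemma step_law_le x n A B : (forall u, enorm u = 1 -> A (x n + u) -> B (x n + u)) ->
  step_law x n A <= step_law x n B.
Proof.
move=> AB; rewrite /step_law ler_wpM2r ?invr_ge0 ?fine_ge0 ?arc_length_ge0//.
rewrite fine_le ?arc_length_fin// arc_length_le// => u u1 [h1 h2].
by split=> //; exact: AB.
Qed.

Lemma step_law_le1 x n B : step_law x n B <= 1.
Proof.
rewrite /step_law; have [->|h] := eqVneq (fine (arc_length (x n) (allowed x n))) 0.
  by rewrite invr0 mulr0.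
rewrite ler_pdivrMr ?mul1r; last by rewrite lt_def h fine_ge0// arc_length_ge0.
by rewrite fine_le ?arc_length_fin// arc_length_le// => u u1 [h1 h2].
Qed.

Lemma step_law_eq0 x n B : (forall u, enorm u = 1 -> ~ (allowed x n `&` B) (x n + u)) ->
  step_law x n B = 0.
Proof.
move=> h; rewrite /step_law (_ : arc_length _ _ = 0%E) ?mul0r//.
apply/eqP; rewrite eq_le arc_length_ge0 andbT.
rewrite -(measure0 (@lebesgue_measure R)).
by apply: leb_le => t [_ /= /h]; apply; exact: enorm_unitv.
Qed.

Definition open_near x n i : Prop := forall b u, enorm u = 1 ->
  inoct (nearoct i b) u -> allowed x n (x n + u).

Lemma step_law_quarter x n i : open_near x n i ->
  1 / 4 <= step_law x n [set y | thr i <= dot (y - x n) (dir i)].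
Proof.
move=> hi; have p0 := @pi_gt0 R.
have h1 := arc_length_near hi.
have h2 : ((pi / 2)%:E <= arc_length (x n)
    (allowed x n `&` [set y | (thr i <= dot (y - x n) (dir i))%R]))%E.
  apply: (@arc_length_near _ _ _ i) => b u u1 ub; split; first exact: hi ub.
  by rewrite /= [_ + u]addrC addrK; exact: nearoct_thr ub.
have h3 := arc_length_le2pi (x n) (allowed x n).
move: h1 h2 h3; rewrite /step_law.
rewrite -(fineK (arc_length_fin (x n) (allowed x n `&` _))).
rewrite -(fineK (arc_length_fin (x n) (allowed x n))) !lee_fin /= => h1 h2 h3.
by rewrite ler_pdivlMr; lra.
Qed.

(** Hits contain two whole octants, an arc of length [pi / 2], while retreats fit into [backoct i],
    of length [pi / 4]; the normalizing factor is common. *)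
Lemma step_law_back x n i : open_near x n i ->
  (forall u, allowed x n (x n + u) -> dot u (dir i) < 0 -> 0 < dot u (dir (i.1, ~~ i.2))) ->
  2 * step_law x n [set y | dot (y - x n) (dir i) < 0] <=
  step_law x n [set y | thr i <= dot (y - x n) (dir i)].
Proof.
move=> hi hb; have p0 := @pi_gt0 R.
have h2 : ((pi / 2)%:E <= arc_length (x n)
    (allowed x n `&` [set y | (thr i <= dot (y - x n) (dir i))%R]))%E.
  apply: (@arc_length_near _ _ _ i) => b u u1 ub; split; first exact: hi ub.
  by rewrite /= [_ + u]addrC addrK; exact: nearoct_thr ub.
have h3 : (arc_length (x n)
    (allowed x n `&` [set y | (dot (y - x n) (dir i) < 0)%R]) <= (pi / 4)%:E)%E.
  apply: (@arc_length_back _ _ _ (backoct i)) => o u u1 [al] /=.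
  by rewrite [_ + u]addrC addrK => un uo; apply: backoctP uo => //; exact: hb.
have h1 := arc_length_near hi.
move: h1 h2 h3; rewrite /step_law.
rewrite -(fineK (arc_length_fin (x n) (allowed x n `&` [set y | thr i <= _]))).
rewrite -(fineK (arc_length_fin (x n) (allowed x n `&` [set y | dot _ _ < 0]))).
rewrite -(fineK (arc_length_fin (x n) (allowed x n))) !lee_fin /= => h1 h2 h3.
by rewrite mulrA ler_wpM2r ?invr_ge0; lra.
Qed.

Lemma good_open x n i : supp x n (dir i) -> open_near x n i.
Proof.
move=> si b u u1 ub; apply: (allowed_half_plane (dir_neq0 i)) => //.
apply: le_trans (nearoct_thr u1 ub).
by rewrite /thr; case: i.2; lra.
Qed.

Lemma bad_open x n w i : ~~ good x n -> w != 0 -> supp x n w -> oct w = i.1 ->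
  open_near x n i.
Proof.
move=> bad w0 sw wi b u u1 ub; apply: (allowed_half_plane w0) => //.
have [a [c [a0 c0 ->]]] := bad_octP bad w0 sw.
have [h1 h2] := nearoct_ge0 ub.
by rewrite dotDr !dotZr wi addr_ge0// mulr_ge0// ltW.
Qed.

(** An allowed step is not blocked, so [turnP] yields a normal along which it does not decrease.
    That normal is a positive combination of the two borders of the same octant, which is impossible
    if the step decreases along one border and does not increase along the other. *)
Lemma bad_back x n w i : spread x n -> ~~ good x n -> w != 0 -> supp x n w ->
  oct w = i.1 -> forall u, allowed x n (x n + u) -> dot u (dir i) < 0 ->
  0 < dot u (dir (i.1, ~~ i.2)).
Proof.
move=> sp bad w0 sw wi u al ui; rewrite ltNge; apply/negP => ui'.
have nb : ~ blocked x n u by move=> /blocked_allowed.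
have [t0 st ut] := turnP w0 sw nb.
have [a [c [a0 c0 tE]]] := bad_octP bad t0 st.
move: ut; rewrite tE -(bad_oct_eq sp bad w0 t0 sw st) wi leNgt => /negP; apply.
rewrite dotDr !dotZr; move: ui ui'; rewrite /dir /=.
by case: i.2 => /= h1 h2; nra.
Qed.

End Law.

(** * Measurability *)

Section Normal.
Context {R : realType}.
Local Notation plane := (R * R)%type.
Implicit Types (x : nat -> plane).

(** A normal at the newest point, carried along the path. The initial value is arbitrary, as every
    vector is normal to a single point. *)
Fixpoint normal x n : plane :=
  if n is m.+1 then turn x m (x n - x m) (normal x m) else (1, 0).

(* Mentions [x 1], hence only used for [0 < n]. *)
Definition flat x n : bool := [forall i : 'I_n.+1, det (x 1%N) (x i) == 0].

(** A vector orthogonal to all differences is orthogonal to all points because [x 0 = 0]; then [x 1]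
    and every [x i] are parallel. *)
Lemma flatPn x n : x 0%N = 0 -> ~~ flat x n -> spread x n.
Proof.
move=> x0 /forallPn [[i /= lin] hi] w w0.
apply: contrapT => /forall2NP h.
have {}h j : (j <= n)%N -> dot (x j - x n) w = 0.
  by move=> jn; have [//|/negP/negPn/eqP] := h j.
have hn j : (j <= n)%N -> dot (x j) w = 0.
  move=> jn; have := h j jn; have := h 0%N isT.
  by rewrite x0 !dotBl dot0l; lra.
have [n0|n0] := posnP n.
  move: lin; rewrite n0 ltnS leqn0 => /eqP i0.
  by move: hi; rewrite i0 x0 /det /= !mulr0 subrr eqxx.
have h1 := hn _ n0; have h2 := hn i lin.
have ww := plane_neq0 w0.
have E : det (x 1%N) (x i) * dot w w = 0.
  transitivity (dot (x 1%N) w * det w (x i) + dot (x i) w * det (x 1%N) w).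
    by rewrite /det /dot; ring.
  by rewrite h1 h2 !mul0r addr0.
move/eqP: E; rewrite mulf_eq0 (negPf hi) /=.
by rewrite gt_eqF.
Qed.

Lemma flatS x n : flat x n.+1 -> flat x n.
Proof.
move=> /forallP h; apply/forallP => -[i /= lin].
exact: (h (Ordinal (leqW lin : (i < n.+2)%N))).
Qed.

End Normal.

Section Measurability.
Context d (S : measurableType d) {R : realType}.
Local Notation plane := (R * R)%type.
Implicit Types (f g : S -> plane) (X : nat -> S -> plane).

Lemma measurable_fst_comp f : measurable_fun setT f -> measurable_fun setT (fun w => (f w).1).
Proof. by move=> mf; apply: measurableT_comp. Qed.

Lemma measurable_snd_comp f : measurable_fun setT f -> measurable_fun setT (fun w => (f w).2).
Proof. by move=> mf; apply: measurableT_comp. Qed.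

Lemma measurable_plane (f1 f2 : S -> R) : measurable_fun setT f1 -> measurable_fun setT f2 ->
  measurable_fun setT (fun w => (f1 w, f2 w)).
Proof. by move=> h1 h2; apply/measurable_fun_pairP. Qed.

Lemma measurable_planeB f g : measurable_fun setT f -> measurable_fun setT g ->
  measurable_fun setT (fun w => f w - g w).
Proof.
move=> mf mg; apply: measurable_plane; apply: measurable_funB;
  by [exact: measurable_fst_comp|exact: measurable_snd_comp].
Qed.

Lemma measurable_planeN f : measurable_fun setT f -> measurable_fun setT (fun w => - f w).
Proof.
move=> mf; apply: measurable_plane; apply: measurable_funN;
  by [exact: measurable_fst_comp|exact: measurable_snd_comp].
Qed.

Lemma measurable_perp f : measurable_fun setT f -> measurable_fun setT (fun w => perp (f w)).
Proof.
move=> mf; apply: measurable_plane; last exact: measurable_fst_comp.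
by apply: measurable_funN; exact: measurable_snd_comp.
Qed.

Lemma measurable_dot f g : measurable_fun setT f -> measurable_fun setT g ->
  measurable_fun setT (fun w => dot (f w) (g w)).
Proof.
move=> mf mg; rewrite /dot; apply: measurable_funD; apply: measurable_funM;
  by [exact: measurable_fst_comp|exact: measurable_snd_comp].
Qed.

Lemma measurable_det f g : measurable_fun setT f -> measurable_fun setT g ->
  measurable_fun setT (fun w => det (f w) (g w)).
Proof.
move=> mf mg; rewrite /det; apply: measurable_funB; apply: measurable_funM;
  by [exact: measurable_fst_comp|exact: measurable_snd_comp].
Qed.

Lemma measurable_bigmax m (F : nat -> S -> R) :
  (forall i, (i < m)%N -> measurable_fun setT (F i)) ->
  measurable_fun setT (fun w => \big[Num.max/0]_(i < m) F i w).
Proof.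
elim: m F => [|m ih] F mF; first by under eq_fun do rewrite big_ord0; exact: measurable_cst.
under eq_fun do rewrite big_ord_recl /=.
apply: measurable_maxr; first exact: mF.
by apply: (ih (fun i => F i.+1)) => i im; exact: mF.
Qed.

Lemma measurable_gap X n f : (forall i, (i <= n)%N -> measurable_fun setT (X i)) ->
  measurable_fun setT f -> measurable_fun setT (fun w => gap (X^~ w) n (f w)).
Proof.
move=> mX mf; apply: (@measurable_bigmax n.+1 (fun i w => dot (X i w - X n w) (f w))) => i lin.
by apply: measurable_dot => //; apply: measurable_planeB; exact: mX.
Qed.

Lemma measurable_supp X n f : (forall i, (i <= n)%N -> measurable_fun setT (X i)) ->
  measurable_fun setT f -> measurable_fun setT (fun w => supp (X^~ w) n (f w)).
Proof.
by move=> mX mf; apply: measurable_fun_ler => //; exact: measurable_gap.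
Qed.

Lemma measurable_has (I : Type) (s : seq I) (F : I -> S -> bool) :
  (forall i, measurable_fun setT (F i)) -> measurable_fun setT (fun w => has (F^~ w) s).
Proof.
by move=> mF; elim: s => [|i s ih] //=; exact: measurable_or.
Qed.

Lemma measurable_exists (I : finType) (F : I -> S -> bool) :
  (forall i, measurable_fun setT (F i)) -> measurable_fun setT (fun w => [exists i, F i w]).
Proof.
move=> mF; rewrite (_ : (fun w => _) = (fun w => has (F^~ w) (enum I))).
  exact: measurable_has.
apply/funext => w; apply/existsP/hasP => -[i]; last by exists i.
by exists i => //; rewrite mem_enum.
Qed.

Lemma measurable_forall (I : finType) (F : I -> S -> bool) :
  (forall i, measurable_fun setT (F i)) -> measurable_fun setT (fun w => [forall i, F i w]).
Proof.
move=> mF; under eq_fun do rewrite -[[forall i, _]]negbK negb_forall.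
by apply: measurable_neg; apply: measurable_exists => i; exact: measurable_neg.
Qed.

Lemma measurable_good X n : (forall i, (i <= n)%N -> measurable_fun setT (X i)) ->
  measurable_fun setT (fun w => good (X^~ w) n).
Proof. by move=> mX; apply: measurable_exists => i; exact: measurable_supp. Qed.

Lemma measurable_flat X n : (0 < n)%N ->
  (forall i, (i <= n)%N -> measurable_fun setT (X i)) ->
  measurable_fun setT (fun w => flat (X^~ w) n).
Proof.
move=> n0 mX; apply: measurable_forall => i.
apply: measurable_fun_eqr => //; apply: measurable_det; apply: mX => //.
by rewrite -ltnS.
Qed.

Lemma measurable_normal X n : (forall i, (i <= n)%N -> measurable_fun setT (X i)) ->
  measurable_fun setT (fun w => normal (X^~ w) n).
Proof.
elim: n => [|n ih] mX //=.
have mX' i : (i <= n)%N -> measurable_fun setT (X i) by move=> /leqW; exact: mX.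
have mu : measurable_fun setT (fun w => X n.+1 w - X n w).
  by apply: measurable_planeB; [exact: mX|exact: mX'].
have mp := measurable_perp mu.
have mw := ih mX'.
apply: measurable_fun_ifT => //.
  by apply: measurable_fun_ler => //; exact: measurable_dot.
apply: measurable_fun_ifT => //; first exact: measurable_supp.
apply: measurable_fun_ifT; last exact: measurable_planeN.
  by apply: measurable_supp => //; exact: measurable_planeN.
exact: measurable_planeN.
Qed.

Lemma measurable_eqb (b : bool) (f : S -> bool) : measurable_fun setT f ->
  measurable_fun setT (fun w => b == f w).
Proof.
move=> mf; case: b; first by under eq_fun do rewrite eq_sym eqb_id.
by under eq_fun do rewrite eq_sym eqbF_neg; exact: measurable_neg.
Qed.

Lemma measurable_oct f o : measurable_fun setT f -> measurable_fun setT (fun w => o == oct (f w)).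
Proof.
move=> mf; case: o => [[a b] c]; rewrite /oct.
under eq_fun do rewrite !xpair_eqE.
have m1 := measurable_fst_comp mf; have m2 := measurable_snd_comp mf.
have n1 : measurable_fun setT (fun w => `|(f w).1|) by apply: measurableT_comp.
have n2 : measurable_fun setT (fun w => `|(f w).2|) by apply: measurableT_comp.
by apply: measurable_and; [apply: measurable_and|]; apply: measurable_eqb; exact: measurable_fun_ltr.
Qed.

(** As [oct] takes finitely many values, the composition is a finite combination of indicators. *)
Lemma measurable_octdir (g : octant -> plane) f : measurable_fun setT f ->
  measurable_fun setT (fun w => g (oct (f w))).
Proof.
move=> mf.
have E w : g (oct (f w)) = \sum_(o : octant) (o == oct (f w))%:R *: g o.
  rewrite (bigD1 (oct (f w)))//= eqxx scale1r big1 ?addr0// => o /negPf ->.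
  by rewrite scale0r.
suff H : forall s : seq octant,
    measurable_fun setT (fun w => \sum_(o <- s) (o == oct (f w))%:R *: g o).
  by under eq_fun do rewrite E; exact: H.
elim=> [|o s ih].
  by under eq_fun do rewrite big_nil; exact: measurable_cst.
under eq_fun do rewrite big_cons.
have m1 : measurable_fun setT (fun w => if o == oct (f w) then g o else 0).
  by apply: measurable_fun_ifT => //; exact: measurable_oct.
have m2 : measurable_fun setT (fun w => (o == oct (f w))%:R *: g o).
  apply: eq_measurable_fun m1 => w _; case: ifP => _; by rewrite ?scale1r ?scale0r.
apply: measurable_plane; apply: measurable_funD;
  by [exact: measurable_fst_comp|exact: measurable_snd_comp].
Qed.

Lemma measurable_anchor X n f i : (forall i, (i <= n)%N -> measurable_fun setT (X i)) ->
  measurable_fun setT f -> measurable_fun setT (fun w => anchor (X^~ w) n (f w) i).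
Proof.
move=> mX mf; apply: measurable_and.
  by apply: measurable_neg; exact: measurable_good.
case: i => o s; under eq_fun do rewrite xpair_eqE.
apply: measurable_and; first exact: measurable_oct.
by apply: measurable_eqb; apply: measurable_fun_ler;
  apply: measurable_gap => //; exact: (measurable_octdir _ mf).
Qed.

End Measurability.

(** * Conditional probabilities of half-planes *)

Section LowerIntegral.
Context d (T : measurableType d) (R : realType).
Local Open Scope ereal_scope.
Import HBNNSimple.

(* [\int] of a nonnegative function is a supremum over simple functions, so
   this holds without any measurability assumption on [f] and [g]. *)
Lemma le_lower_integral (mu : {measure set T -> \bar R}) (D : set T) (f g : T -> R) (k : R) :
  (0 <= k)%R -> (forall w, 0 <= f w)%R -> (forall w, 0 <= g w)%R ->
  (forall w, D w -> k * f w <= g w)%R ->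
  k%:E * \int[mu]_(w in D) (f w)%:E <= \int[mu]_(w in D) (g w)%:E.
Proof.
move=> k0 f0 g0 fg.
have [->|kn0] := eqVneq k 0%R.
  by rewrite mul0e integral_ge0// => w _; rewrite lee_fin.
have {}k0 : (0 < k)%R by rewrite lt_def kn0.
rewrite -lee_pdivlMl// ge0_integralE => [|w _]; last by rewrite lee_fin.
apply: ge_ereal_sup => _ [h /= hf <-].
rewrite lee_pdivlMl// -sintegralrM ge0_integralE => [|w _]; last by rewrite lee_fin.
apply: ereal_sup_ubound; exists (scale_nnsfun h (ltW k0)) => //= w.
have := hf w; rewrite !patchE; case: ifPn => [|_]; last first.
  by rewrite !lee_fin => hw; rewrite mulr_ge0_le0// ltW.
rewrite inE => Dw; rewrite !lee_fin => hw.
by apply: le_trans (fg w Dw); rewrite ler_pM2l.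
Qed.

Lemma le_measure_partition (mu : {measure set T -> \bar R}) (F : (set T)^nat)
    (A B : set T) (k : R) : (0 <= k)%R ->
  (forall j, measurable (F j)) -> trivIset setT F -> \bigcup_j F j = setT ->
  measurable A -> measurable B ->
  (forall j, k%:E * mu (F j `&` A) <= mu (F j `&` B)) -> k%:E * mu A <= mu B.
Proof.
move=> k0 mF tF cF mA mB h.
have E C : measurable C -> mu C = \sum_(0 <= j <oo) mu (F j `&` C).
  move=> mC; rewrite -[in LHS](setTI C) -cF setI_bigcupl measure_bigcup//.
  - by apply: eq_eseriesl => j; apply/mem_set.
  - by move=> j _; apply: measurableI.
  - by apply: trivIset_setIr.
rewrite (E A)// (E B)// -nneseriesZl//.
by apply: lee_nneseries => // j _ _; rewrite mule_ge0.
Qed.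

End LowerIntegral.

Section Process.
Context d (T : measurableType d) (R : realType) (P : probability T R).
Local Notation plane := (R * R)%type.
Context (x : nat -> T -> plane) (rp : rancher_process P x).

Definition hist n := g_sigma_algebraType
  (\bigcup_(i in `I_n.+1) preimage_set_system setT (x i) measurable).

Lemma measurable_hist n i : (i <= n)%N -> measurable_fun (setT : set (hist n)) (x i).
Proof.
move=> lin _ B mB; rewrite setTI; apply: sub_sigma_algebra.
by exists i => //; exists B => //; rewrite setTI.
Qed.

Lemma historyP n (f : T -> bool) : measurable_fun (setT : set (hist n)) f ->
  history x n [set w | f w].
Proof.
move=> mf; have := mf measurableT [set true] (ltac:(done)).
by rewrite setTI; congr (history x n _); apply/seteqP; split.
Qed.

Lemma measurable_step n : measurable_fun setT (x n).
Proof. by case: rp. Qed.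

Lemma history_measurable n E : history x n E -> measurable E.
Proof.
apply: smallest_sub; first exact: sigma_algebra_measurable.
move=> _ [i _ [B mB <-]]; exact: measurable_step.
Qed.

Lemma historyS n m E : (n <= m)%N -> history x n E -> history x m E.
Proof.
move=> nm; apply: sub_sigma_algebra2.
by apply: bigcup_subset => i /= h; apply: leq_trans h _.
Qed.

Lemma historyI n E F : history x n E -> history x n F -> history x n (E `&` F).
Proof. exact: (@measurableI _ (hist n)). Qed.

Lemma step_lawE n E B : history x n E -> measurable B ->
  (P (E `&` x n.+1 @^-1` B) = \int[P]_(w in E) (step_law (x^~ w) n B)%:E)%E.
Proof. by case: rp => _ _; apply. Qed.

Lemma measurable_halfplane_lt (v : plane) (c : R) :
  measurable [set y : plane | dot y v < c].
Proof.
have /(_ measurableT [set true] (ltac:(done))) :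
    measurable_fun setT (fun y : plane => dot y v < c).
  by apply: measurable_fun_ltr => //; exact: measurable_dot.
by rewrite setTI; congr measurable; apply/seteqP; split.
Qed.

Lemma measurable_halfplane_ge (v : plane) (c : R) :
  measurable [set y : plane | c <= dot y v].
Proof.
have -> : [set y : plane | c <= dot y v] = ~` [set y | dot y v < c].
  by apply/seteqP; split => y /=; [move=> h; apply/negP; rewrite -leNgt|move=> /negP; rewrite -leNgt].
by apply: measurableC; exact: measurable_halfplane_lt.
Qed.

Lemma measurable_incr n (v : plane) (f : R -> bool) :
  measurable_fun setT f -> measurable [set w | f (dot (x n.+1 w - x n w) v)].
Proof.
move=> mf.
have /(_ measurableT [set true] (ltac:(done))) :
    measurable_fun setT (fun w => f (dot (x n.+1 w - x n w) v)).
  apply: measurableT_comp => //; apply: measurable_dot => //.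
  by apply: measurable_planeB; exact: measurable_step.
by rewrite setTI; congr measurable; apply/seteqP; split.
Qed.

Lemma measurable_incr_lt n (v : plane) (c : R) :
  measurable [set w | dot (x n.+1 w - x n w) v < c].
Proof. by apply: (@measurable_incr _ _ (fun r => r < c)); exact: measurable_fun_ltr. Qed.

Lemma measurable_incr_ge n (v : plane) (c : R) :
  measurable [set w | c <= dot (x n.+1 w - x n w) v].
Proof. by apply: (@measurable_incr _ _ (fun r => c <= r)); exact: measurable_fun_ler. Qed.

(* [step_law] speaks about events [x n.+1 \in B] with [B] deterministic, so
   [dot (x n) v] is first discretized with mesh [h]. *)
Lemma half_plane_mesh n (E : set T) (v : plane) (a b k h : R) : 0 < h ->
  history x n E -> 0 <= k ->
  (forall w, E w -> k * step_law (x^~ w) n [set y | dot (y - x n w) v < b] <=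
     step_law (x^~ w) n [set y | a <= dot (y - x n w) v]) ->
  (k%:E * P (E `&` [set w | (dot (x n.+1 w - x n w) v < b - h)%R]) <=
   P (E `&` [set w | (a - h <= dot (x n.+1 w - x n w) v)%R]))%E.
Proof.
move=> h0 mE k0 hE.
pose fl w : int := Num.floor (dot (x n w) v / h).
pose F j : set T := if @pickle_inv int j is Some m
  then [set w | (m%:~R * h <= dot (x n w) v) && (dot (x n w) v < (m + 1)%:~R * h)] else set0.
have Ffl w m : (m%:~R * h <= dot (x n w) v) && (dot (x n w) v < (m + 1)%:~R * h) <-> fl w = m.
  rewrite /fl; split.
    move=> /andP[h1 h2]; apply: floor_def.
    by rewrite ler_pdivlMr// ltr_pdivrMr// h1.
  by move=> <-; rewrite -ler_pdivlMr// -ltr_pdivrMr// floor_itv.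
have mF j : history x n (F j).
  rewrite /F; case: pickle_inv => [m|]; last exact: (@measurable0 _ (hist n)).
  apply: historyP; apply: measurable_and.
    by apply: measurable_fun_ler => //; apply: measurable_dot => //; exact: measurable_hist.
  by apply: measurable_fun_ltr => //; apply: measurable_dot => //; exact: measurable_hist.
apply: (@le_measure_partition _ _ _ _ F) => //.
- by move=> j; exact: history_measurable (mF j).
- apply/trivIsetP => j j' _ _ jj'; rewrite -subset0 => w [].
  rewrite /F; case E1 : pickle_inv => [m|//]; case E2 : pickle_inv => [m'|//].
  move=> /Ffl mE1 /Ffl mE2; move/eqP: jj'; apply.
  have := @pickle_invK int j; have := @pickle_invK int j'.
  by rewrite /ocancel E1 E2 /= -mE1 -mE2 => <- <-.
- rewrite -subTset => w _.
  by exists (pickle (fl w)); [exact: I|rewrite /F pickleK_inv; exact/Ffl].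
- by apply: measurableI; [exact: history_measurable mE|exact: measurable_incr_lt].
- by apply: measurableI; [exact: history_measurable mE|exact: measurable_incr_ge].
move=> j; rewrite !setIA.
have mEF : history x n (F j `&` E) by exact: historyI.
have mEF' := history_measurable mEF.
move: (mF j) mEF mEF'; rewrite /F; case: pickle_inv => [m|]; last first.
  by rewrite !set0I !measure0 mule0.
set G := [set w | _] => _ mEF mEF'.
(* On the cell [G], [dot (x n w) v] lies in [[m * h, (m + 1) * h[]. Replacing it by [m * h] gives
   deterministic half-planes; the error, less than [h], is what [b - h] and [a - h] leave room
   for. *)
pose A := [set y : plane | m%:~R * h + a <= dot y v].
pose B := [set y : plane | dot y v < m%:~R * h + b].
have mA : measurable A by exact: measurable_halfplane_ge.
have mB : measurable B by exact: measurable_halfplane_lt.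
have m1 : (m + 1)%:~R = m%:~R + 1 :> R by rewrite intrD.
apply: (@le_trans _ _ (k%:E * P ((G `&` E) `&` x n.+1 @^-1` B))%E).
  rewrite lee_wpmul2l//; apply: le_measure; rewrite ?inE.
  - by apply: measurableI => //; exact: measurable_incr_lt.
  - by apply: measurableI => //; rewrite -[X in measurable X]setTI; exact: measurable_step.
  - move=> w [[/andP[G1 G2] Ew]] /=; rewrite dotBl => hw.
    split; first by split => //; apply/andP.
    by rewrite /B /=; move: G2; rewrite m1; lra.
apply: (@le_trans _ _ (P ((G `&` E) `&` x n.+1 @^-1` A))%E); last first.
  apply: le_measure; rewrite ?inE.
  - by apply: measurableI => //; rewrite -[X in measurable X]setTI; exact: measurable_step.
  - by apply: measurableI => //; exact: measurable_incr_ge.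
  - move=> w [[/andP[G1 G2] Ew]]; rewrite /A /= => hw.
    split; first by split => //; apply/andP.
    by rewrite /= dotBl; move: G2; rewrite m1; lra.
rewrite !step_lawE//; apply: le_lower_integral => //.
- by move=> w; exact: step_law_ge0.
- by move=> w; exact: step_law_ge0.
- move=> w [/andP[G1 G2] Ew].
  apply: (@le_trans _ _ (k * step_law (x^~ w) n [set y | dot (y - x n w) v < b])).
    rewrite ler_wpM2l//; apply: step_law_le => u _ /=.
    by rewrite /B /= !dotBl; lra.
  apply: (le_trans (hE w Ew)); apply: step_law_le => u _ /=.
  by rewrite /A /= !dotBl; lra.
Qed.

(** Let the mesh of [half_plane_mesh] tend to [0]. The strict inequality makes the events on the
    left increase to their limit and the weak one makes those on the right decrease to theirs, so
    continuity of [P] applies to both. *)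
Lemma half_plane_step n (E : set T) (v : plane) (a b k : R) :
  history x n E -> 0 <= k ->
  (forall w, E w -> k * step_law (x^~ w) n [set y | dot (y - x n w) v < b] <=
     step_law (x^~ w) n [set y | a <= dot (y - x n w) v]) ->
  (k%:E * P (E `&` [set w | (dot (x n.+1 w - x n w) v < b)%R]) <=
   P (E `&` [set w | (a <= dot (x n.+1 w - x n w) v)%R]))%E.
Proof.
move=> hE k0 hk; have mE := history_measurable hE.
pose h p : R := p.+1%:R^-1.
have h0 p : 0 < h p by rewrite invr_gt0.
have hle p q : (p <= q)%N -> h q <= h p.
  by move=> pq; rewrite lef_pV2 ?posrE// ler_nat.
have hlim r : 0 < r -> exists p, h p < r.
  move=> r0; exists (Num.truncn r^-1); rewrite /h invf_plt ?posrE//.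
  exact: truncnS_gt.
pose G p := E `&` [set w | dot (x n.+1 w - x n w) v < b - h p].
pose H p := E `&` [set w | a - h p <= dot (x n.+1 w - x n w) v].
have mG p : measurable (G p) by apply: measurableI => //; exact: measurable_incr_lt.
have mH p : measurable (H p) by apply: measurableI => //; exact: measurable_incr_ge.
have GE : E `&` [set w | dot (x n.+1 w - x n w) v < b] = \bigcup_p G p.
  apply/seteqP; split => w.
    move=> [Ew /= hw]; have [|p hp] := hlim (b - dot (x n.+1 w - x n w) v); first by lra.
    by exists p => //; split => //=; lra.
  by move=> [p _ [Ew /= hw]]; split => //=; have := h0 p; lra.
have HE : E `&` [set w | a <= dot (x n.+1 w - x n w) v] = \bigcap_p H p.
  apply/seteqP; split => w.
    by move=> [Ew /= hw] p _; split => //=; have := h0 p; lra.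
  move=> hw; split; first by have [] := hw 0%N I.
  rewrite /= leNgt; apply/negP => hlt.
  have [|p hp] := hlim (a - dot (x n.+1 w - x n w) v); first by lra.
  by have [_ /=] := hw p I; lra.
rewrite GE HE.
have cG : (P \o G) @ \oo --> P (\bigcup_p G p).
  apply: nondecreasing_cvg_mu => //; first exact: bigcup_measurable.
  move=> p q pq; apply/subsetPset => w [Ew /= hw]; split => //=.
  by have := hle _ _ pq; lra.
have cH : (P \o H) @ \oo --> P (\bigcap_p H p).
  apply: nonincreasing_cvg_mu => //.
  - by rewrite (le_lt_trans (probability_le1 _ _))// ltry.
  - exact: bigcap_measurable.
  move=> p q pq; apply/subsetPset => w [Ew /= hw]; split => //=.
  by have := hle _ _ pq; lra.
have ckG := cvgeZl (isT : k%:E \is a fin_num) cG.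
rewrite -(cvg_lim _ ckG)// -(cvg_lim _ cH)//; apply: lee_lim.
- by apply/cvg_ex; eexists; exact: ckG.
- by apply/cvg_ex; eexists; exact: cH.
- by apply: nearW => p; exact: half_plane_mesh.
Qed.

End Process.

(** * Almost sure properties of the path *)

Section Null.
Context d (T : measurableType d) (R : realType) (P : probability T R).
Local Notation plane := (R * R)%type.
Context (x : nat -> T -> plane) (rp : rancher_process P x).

Lemma null_step n E B : history x n E -> measurable B ->
  (forall w, E w -> forall u, enorm u = 1 -> ~ (allowed (x^~ w) n `&` B) (x n w + u)) ->
  P.-negligible (E `&` x n.+1 @^-1` B).
Proof.
move=> hE mB h; exists (E `&` x n.+1 @^-1` B); split => //.
  apply: measurableI; first exact: (history_measurable rp hE).
  by rewrite -[X in measurable X]setTI; exact: (measurable_step rp).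
rewrite (step_lawE rp)//; apply: integral0_eq => w Ew.
by rewrite step_law_eq0//; exact: h.
Qed.

Definition box (c : rat * rat) (m : nat) : set plane :=
  [set y | (`|y.1 - ratr c.1| < m.+1%:R^-1) && (`|y.2 - ratr c.2| < m.+1%:R^-1)].

Lemma measurable_box c m : measurable (box c m).
Proof.
have /(_ measurableT [set true] (ltac:(done))) : measurable_fun setT
    (fun y : plane => (`|y.1 - ratr c.1| < m.+1%:R^-1) && (`|y.2 - ratr c.2| < m.+1%:R^-1)).
  by apply: measurable_and; apply: measurable_fun_ltr => //; apply: measurableT_comp => //;
    apply: measurable_funB.
by rewrite setTI; congr measurable; apply/seteqP; split.
Qed.

Lemma box_dense (y : plane) m : exists c, box c m y.
Proof.
have h (r : R) : exists q : rat, `|r - ratr q| < m.+1%:R^-1.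
  have : 0 < m.+1%:R^-1 :> R by [].
  move: (m.+1%:R^-1) => e e0.
  have [|q] := @rat_in_itvoo R (r - e) (r + e); first by lra.
  by rewrite in_itv /= => /andP[h1 h2]; exists q; rewrite ltr_norml; apply/andP; split; lra.
have [q1 h1] := h y.1; have [q2 h2] := h y.2.
by exists (q1, q2); rewrite /box /= h1 h2.
Qed.

Lemma box_det (c : rat * rat) m (y p z : plane) : p != 0 -> box c m y ->
  `|det p (y - z) - det p ((ratr c.1, ratr c.2) - z)| < m.+1%:R^-1 * (`|p.1| + `|p.2|).
Proof.
move=> p0 /andP[h1 h2].
have -> : det p (y - z) - det p ((ratr c.1, ratr c.2) - z) =
    p.1 * (y.2 - ratr c.2) - p.2 * (y.1 - ratr c.1) by rewrite /det /=; ring.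
apply: le_lt_trans (ler_normB _ _) _; rewrite !normrM.
have : 0 < `|p.1| + `|p.2|.
  case: (p) p0 => a b /= ab; rewrite lt_def addr_ge0// andbT paddr_eq0//.
  by rewrite !normr_eq0; apply: contra ab => /andP[/eqP-> /eqP->].
have n1 := normr_ge0 p.1; have n2 := normr_ge0 p.2 => p12.
move: h1 h2; set e := _^-1; set a := `|y.1 - _|; set c2 := `|y.2 - _| => h1 h2.
have mu0 : 0 < Num.min (e - a) (e - c2) by rewrite lt_min !subr_gt0 h1.
have mu1 : Num.min (e - a) (e - c2) <= e - a by rewrite ge_min lexx.
have mu2 : Num.min (e - a) (e - c2) <= e - c2 by rewrite ge_min lexx orbT.
have := mulr_gt0 mu0 p12; have := ler_wpM2l n1 mu2; have := ler_wpM2l n2 mu1.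
by lra.
Qed.

(** The blocked region is random but open. It is covered by countably many rational boxes, each
    paired with the history event that the whole box is blocked, and [null_step] applies to every
    pair. *)
Lemma negligible_blocked n i j k (b : bool) : (i <= n)%N -> (j <= n)%N -> (k <= n)%N ->
  P.-negligible [set w | let p := x i w - x n w in let q := x j w - x n w in
    let r := (x n.+1 w - x n w) - b%:R *: (x k w - x n w) in
    [/\ 0 < det p q, 0 < det p r & 0 < det r q]].
Proof.
move=> lin jn kn.
pose p w := x i w - x n w; pose q w := x j w - x n w.
pose s w := b%:R *: (x k w - x n w).
pose t w := x n w + s w.
pose e m : R := m.+1%:R^-1.
pose cc (c : rat * rat) : plane := (ratr c.1, ratr c.2).
(* The determinants at the centre of the box exceed their oscillation over the box, bounded in
   [box_det], so they keep their sign on all of it. *)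
pose E c m : set T := [set w | [&& 0 < det (p w) (q w),
  e m * (`|(p w).1| + `|(p w).2|) < det (p w) (cc c - t w) &
  e m * (`|(q w).1| + `|(q w).2|) < - det (q w) (cc c - t w)]].
have mx l : (l <= n)%N -> measurable_fun (setT : set (hist x n)) (x l) by exact: measurable_hist.
have mp : measurable_fun (setT : set (hist x n)) p by apply: measurable_planeB; exact: mx.
have mq : measurable_fun (setT : set (hist x n)) q by apply: measurable_planeB; exact: mx.
have mt : measurable_fun (setT : set (hist x n)) t.
  have mk : measurable_fun (setT : set (hist x n)) (fun w => x k w - x n w).
    by apply: measurable_planeB; exact: mx.
  have m1 := measurable_fst_comp mk; have m2 := measurable_snd_comp mk.
  have m3 := measurable_fst_comp (mx _ (leqnn n)).
  have m4 := measurable_snd_comp (mx _ (leqnn n)).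
  apply: measurable_plane; apply: measurable_funD => //; exact: measurable_funM.
have mnorm (f : T -> plane) : measurable_fun (setT : set (hist x n)) f ->
    measurable_fun (setT : set (hist x n)) (fun w => `|(f w).1| + `|(f w).2|).
  move=> mf; apply: measurable_funD; apply: measurableT_comp => //;
    by [exact: measurable_fst_comp|exact: measurable_snd_comp].
have mE c m : history x n (E c m).
  apply: historyP; apply: measurable_and; first by apply: measurable_fun_ltr => //; exact: measurable_det.
  have mct : measurable_fun (setT : set (hist x n)) (fun w => cc c - t w).
    by apply: measurable_planeB => //; exact: measurable_cst.
  apply: measurable_and; apply: measurable_fun_ltr.
  - by apply: measurable_funM => //; exact: mnorm.
  - exact: measurable_det.
  - by apply: measurable_funM => //; exact: mnorm.
  - by apply: measurable_funN; exact: measurable_det.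
pose F l : set T := if @pickle_inv (rat * rat * nat)%type l is Some cm
  then E cm.1 cm.2 `&` x n.+1 @^-1` box cm.1 cm.2 else set0.
have neq0 (y z : plane) : 0 < det y z -> y != 0 /\ z != 0.
  by move=> h; split; apply: contraTneq h => ->; rewrite /det /= ?mul0r ?mulr0 subrr ltxx.
have tE w y : y - x n w - b%:R *: (x k w - x n w) = y - t w.
  by rewrite /t /s opprD addrA.
apply: (negligibleS (A := \bigcup_l F l)); last first.
  apply: negligible_bigcup => l; rewrite /F; case: pickle_inv => [[c m]|]; last exact: negligible_set0.
  apply: null_step; [exact: mE|exact: measurable_box|].
  move=> w /and3P[h1 h2 h3] u _ [al bx].
  have [p0 q0] := neq0 _ _ h1.
  apply: (blocked_allowed _ al); exists i, j, k, b; split; first by split.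
  rewrite /= -/(p w) -/(q w).
  have uE : u - b%:R *: (x k w - x n w) = (x n w + u) - t w.
    by rewrite -tE [x n w + u]addrC addrK.
  rewrite uE; split => //.
    by have := box_det (t w) p0 bx; rewrite -/(cc c) -/(e m) ltr_norml => /andP[h4 _]; lra.
  have := box_det (t w) q0 bx; rewrite -/(cc c) -/(e m) ltr_norml => /andP[_ h4].
  have -> : det (x n w + u - t w) (q w) = - det (q w) (x n w + u - t w) by rewrite /det; ring.
  by lra.
move=> w /=; rewrite tE -/(p w) -/(q w) => -[h1 h2 h3].
have [p0 q0] := neq0 _ _ h1.
have h3' : 0 < - det (q w) (x n.+1 w - t w).
  by move: h3; rewrite /det; lra.
pose L := `|(p w).1| + `|(p w).2| + (`|(q w).1| + `|(q w).2|) + 1.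
have L0 : 0 < L by rewrite /L; rewrite ltr_wpDl// !addr_ge0.
pose dl := Num.min (det (p w) (x n.+1 w - t w)) (- det (q w) (x n.+1 w - t w)).
have dl0 : 0 < dl by rewrite lt_min h2 h3'.
(* One [e m * L] is lost in passing from [x n.+1 w] to the centre of the box, the other is the
   margin demanded by [E c m]. *)
have [m hm] : exists m, 2 * e m * L < dl.
  exists (Num.truncn (2 * L / dl)).
  have : 2 * L / dl < (Num.truncn (2 * L / dl)).+1%:R by exact: truncnS_gt.
  rewrite ltr_pdivrMr// /e => h.
  by rewrite -mulrA [_^-1 * _]mulrC mulrA ltr_pdivrMr// [dl * _]mulrC.
have [c bx] := box_dense (x n.+1 w) m.
suff Fw : (E c m `&` x n.+1 @^-1` box c m) w.
  by exists (pickle (c, m)); [exact: I|rewrite /F pickleK_inv; exact: Fw].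
split; last exact: bx.
have e0 : 0 < e m by rewrite /e invr_gt0.
have hp := box_det (t w) p0 bx; have hq := box_det (t w) q0 bx.
move: hp hq; rewrite -/(cc c) -/(e m) !ltr_norml => /andP[a1 a2] /andP[a3 a4].
have d1 : dl <= det (p w) (x n.+1 w - t w) by rewrite ge_min lexx.
have d2 : dl <= - det (q w) (x n.+1 w - t w) by rewrite ge_min lexx orbT.
have b1 : e m * (`|(p w).1| + `|(p w).2|) <= e m * L.
  by rewrite ler_pM2l// /L -addrA lerDl !addr_ge0.
have b2 : e m * (`|(q w).1| + `|(q w).2|) <= e m * L.
  by rewrite ler_pM2l// /L -addrA [X in _ <= X]addrCA lerDl !addr_ge0.
by apply/and3P; split => //; lra.
Qed.

Lemma ae_unblocked n : {ae P, forall w, ~ blocked (x^~ w) n (x n.+1 w - x n w)}.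
Proof.
pose A (t : 'I_n.+1 * 'I_n.+1 * 'I_n.+1 * bool) : set T :=
  [set w | let p := x t.1.1.1 w - x n w in let q := x t.1.1.2 w - x n w in
    let r := (x n.+1 w - x n w) - t.2%:R *: (x t.1.2 w - x n w) in
    [/\ 0 < det p q, 0 < det p r & 0 < det r q]].
have nA t : P.-negligible (A t).
  by apply: negligible_blocked; rewrite -ltnS.
have : {ae P, forall w t, ~ A t w}.
  apply: filter_forall => t; apply: (negligibleS (A := A t)); last exact: nA.
  by move=> w /contrapT.
apply: filterS => w h [i [j [k [b [[hi hj hk] hb]]]]].
exact: (h (Ordinal (hi : (i < n.+1)%N), Ordinal (hj : (j < n.+1)%N), Ordinal (hk : (k < n.+1)%N), b)).
Qed.

(** [half_plane_step] is used in the direction [- dir i] with arbitrary [k]: the law gives no mass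
    to steps beyond [bnd i], so [k * P A <= 1] for every [k], which forces [P A = 0]. *)
Lemma ae_bnd n i : {ae P, forall w, dot (x n.+1 w - x n w) (dir i) <= bnd i}.
Proof.
pose A := [set w | dot (x n.+1 w - x n w) (- dir i) < - bnd i].
have mA : measurable A by exact: (measurable_incr_lt rp).
have hA (k : R) : 0 <= k -> (k%:E * P A <= 1)%E.
  move=> k0; rewrite -(setTI A).
  apply: le_trans (half_plane_step rp (a := 0) _ k0 _) _.
  - exact: (@measurableT _ (hist x n)).
  - move=> w _; rewrite step_law_eq0 ?mulr0 ?step_law_ge0// => u u1 [_] /=.
    by rewrite [_ + u]addrC addrK dotNr ltrN2 ltNge unit_bnd.
  - apply: probability_le1; apply: measurableI => //; exact: (measurable_incr_ge rp).
exists A; split => //; last first.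
  by move=> w /= /negP; rewrite -ltNge /A /= dotNr ltrN2.
apply/eqP; rewrite eq_le measure_ge0 andbT leNgt; apply/negP => PA.
have fA : P A \is a fin_num by exact: fin_num_measure.
move: (hA (2 / fine (P A))) PA; rewrite -(fineK fA) lte_fin -EFinM lee_fin /= => h PA.
have /h : 0 <= 2 / fine (P A) by rewrite divr_ge0// ltW.
by rewrite divfK ?gt_eqF//; lra.
Qed.

Lemma ae_first_neq0 : {ae P, forall w, x 1%N w <> 0}.
Proof.
have x0 w : x 0%N w = 0 by case: rp.
have m0 : measurable [set (0 : plane)].
  have /(_ measurableT [set true] (ltac:(done))) : measurable_fun setT
    (fun y : plane => (y.1 == 0) && (y.2 == 0)).
    by apply: measurable_and; apply: measurable_fun_eqr.
  rewrite setTI; congr measurable; apply/seteqP; split => -[a b] /=.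
    by move=> /andP[/eqP-> /eqP->].
  by move=> [-> ->]; rewrite !eqxx.
apply: (negligibleS (A := setT `&` x 1%N @^-1` [set 0])); last first.
  apply: null_step => //; first exact: (@measurableT _ (hist x 0)).
  move=> w _ u u1 [_ /=]; rewrite x0 add0r => u0.
  by move: u1; rewrite u0 /enorm /= expr0n addr0 sqrtr0 => /esym/eqP; rewrite oner_eq0.
by move=> w /= /contrapT.
Qed.

(** The unit length of the steps is retained only through its projections on the test directions. *)
Definition regular_path w : Prop :=
  [/\ forall n, ~ blocked (x^~ w) n (x n.+1 w - x n w),
      forall n i, dot (x n.+1 w - x n w) (dir i) <= bnd i & x 1%N w <> 0].

Lemma ae_regular : {ae P, forall w, regular_path w}.
Proof.
have h1 : {ae P, forall w n, ~ blocked (x^~ w) n (x n.+1 w - x n w)}.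
  by apply: ae_foralln => n; exact: ae_unblocked.
have h2 : {ae P, forall w n i, dot (x n.+1 w - x n w) (dir i) <= bnd i}.
  apply: ae_foralln => n; apply: filter_forall => i; exact: ae_bnd.
have h3 := ae_first_neq0.
by apply: filterS3 h1 h2 h3 => w; split.
Qed.

End Null.

(** * Integrals of finite combinations of indicators *)

Section Comb.
Context d (T : measurableType d) (R : realType) (P : probability T R).

Lemma measurable_pred (b : T -> bool) : measurable_fun setT b -> measurable [set w | b w].
Proof.
move=> mb; have := mb measurableT [set true] (ltac:(done)).
by rewrite setTI; congr measurable; apply/seteqP; split.
Qed.

Lemma bool_integral (D : set T) (b : T -> bool) (c : R) : measurable D -> measurable_fun setT b ->
  P.-integrable D (EFin \o (fun w => c * (b w)%:R)) /\
  \int[P]_(w in D) (c * (b w)%:R) = c * fine (P (D `&` [set w | b w])).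
Proof.
move=> mD mb; have mB := measurable_pred mb.
have E : (fun w => (b w)%:R : R) = \1_[set w | b w].
  apply/funext => w; rewrite indicE; congr ((nat_of_bool _)%:R).
  by apply/idP/idP; rewrite inE.
have i1 : P.-integrable D (EFin \o (fun w => (b w)%:R : R)).
  rewrite E; apply: (integrableS measurableT) => //.
  exact: integrable_indic.
split.
  by apply: eq_integrable (integrableZl mD c i1) => // w _; rewrite /= EFinM.
by rewrite RintegralZl// E /Rintegral integral_indic// setIC.
Qed.

Lemma comb_integral (I : Type) (s : seq I) (D : set T) (b : I -> T -> bool) (c : I -> R) :
  measurable D -> (forall i, measurable_fun setT (b i)) ->
  P.-integrable D (EFin \o (fun w => \sum_(i <- s) c i * (b i w)%:R)) /\
  \int[P]_(w in D) (\sum_(i <- s) c i * (b i w)%:R) =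
    \sum_(i <- s) c i * fine (P (D `&` [set w | b i w])).
Proof.
move=> mD mb; elim: s => [|i s [ih1 ih2]].
  have E : (fun w => \sum_(i <- [::]) c i * (b i w)%:R) = cst 0 :> (T -> R).
    by apply/funext => w; rewrite big_nil.
  rewrite E big_nil; split; first exact: integrable0.
  by rewrite Rintegral_cst// mul0r.
have E : (fun w => \sum_(j <- i :: s) c j * (b j w)%:R) =
    (fun w => c i * (b i w)%:R + \sum_(j <- s) c j * (b j w)%:R) :> (T -> R).
  by apply/funext => w; rewrite big_cons.
have [h1 h2] := bool_integral (c i) mD (mb i).
rewrite E big_cons; split.
  by apply: eq_integrable (integrableD mD h1 ih1) => // w _; rewrite /= EFinD.
by rewrite RintegralD// h2 ih2.
Qed.

Lemma cover_prob (I : finType) (D : set T) (b : I -> T -> bool) :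
  measurable D -> (forall i, measurable_fun setT (b i)) ->
  (forall w, D w -> exists i, b i w) ->
  fine (P D) <= \sum_i fine (P (D `&` [set w | b i w])).
Proof.
move=> mD mb h.
have [i1 e1] := comb_integral (index_enum I) (fun=> 1) mD mb.
have <- : \sum_i 1 * fine (P (D `&` [set w | b i w])) = \sum_i fine (P (D `&` [set w | b i w])).
  by apply: eq_bigr => i _; rewrite mul1r.
rewrite -e1 -[leLHS]mul1r -Rintegral_cst//; apply: le_Rintegral => //.
  apply: (integrableS measurableT) => //.
  exact: finite_measure_integrable_cst.
by move=> w /h [i bi]; rewrite (bigD1 i)//= bi mulr1 lerDl sumr_ge0.
Qed.

Lemma fine_prob_le (A B : set T) : measurable A -> measurable B -> A `<=` B ->
  fine (P A) <= fine (P B).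
Proof.
by move=> mA mB AB; rewrite fine_le ?fin_num_measure// le_measure ?inE.
Qed.

Lemma fine_prob_ge0 (A : set T) : 0 <= fine (P A).
Proof. by rewrite fine_ge0. Qed.

Lemma fine_prob_le1 (A : set T) : measurable A -> fine (P A) <= 1.
Proof.
by move=> mA; rewrite -[leRHS]/(fine 1%E) fine_le ?fin_num_measure// probability_le1.
Qed.

Lemma fine_probD (A B : set T) : measurable A -> measurable B ->
  fine (P A) = fine (P (A `&` B)) + fine (P (A `\` B)).
Proof.
move=> mA mB; rewrite -fineD ?fin_num_measure//; [|exact: measurableI|exact: measurableD].
by congr fine; rewrite [in LHS](measureDI P mA mB) addeC.
Qed.

End Comb.

(** * Mean gain *)

Section Mean.
Context d (T : measurableType d) (R : realType) (P : probability T R).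
Local Notation plane := (R * R)%type.
Context (x : nat -> T -> plane) (rp : rancher_process P x).
Context (Ok : set T) (mOk : measurable Ok) (POk : P (~` Ok) = 0%E)
  (okP : forall w, Ok w -> regular_path x w).

Local Notation pr A := (fine (P A)).

Lemma pr_Ok A : measurable A -> pr (A `&` Ok) = pr A.
Proof.
move=> mA; rewrite [RHS](fine_probD P mA mOk) (_ : P (A `\` Ok) = 0%E) ?addr0//.
apply: (subset_measure0 _ _ _ POk); first exact: measurableD.
  exact: measurableC.
by move=> w [].
Qed.

Lemma ok_normal w : Ok w -> forall n, normal (x^~ w) n != 0 /\ supp (x^~ w) n (normal (x^~ w) n).
Proof.
move=> /okP [nb _ _]; elim=> [|n [w0 sw]] /=.
  split; first by apply/eqP => -[] /eqP; rewrite oner_eq0.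
  by apply/suppP => i; rewrite leqn0 => /eqP->; rewrite subrr dot0l.
have [t0 st ut] := turnP w0 sw (nb n); split => //.
by rewrite suppS /= (supp_gap st).
Qed.

Definition hits n i w : bool := thr i <= dot (x n.+1 w - x n w) (dir i).
Definition retreats n i w : bool := dot (x n.+1 w - x n w) (dir i) < 0.

Lemma measurable_hits n i : measurable_fun setT (hits n i).
Proof.
apply: measurable_fun_ler => //; apply: measurable_dot => //.
by apply: measurable_planeB; exact: (measurable_step rp).
Qed.

Lemma measurable_retreats n i : measurable_fun setT (retreats n i).
Proof.
apply: measurable_fun_ltr => //; apply: measurable_dot => //.
by apply: measurable_planeB; exact: (measurable_step rp).
Qed.

Lemma hits_quarter n E i : history x n E -> (forall w, E w -> open_near (x^~ w) n i) ->
  1 / 4 * pr E <= pr (E `&` [set w | hits n i w]).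
Proof.
move=> hE oE; have mE := history_measurable rp hE.
have mh : measurable [set w | hits n i w] by exact: (measurable_pred (measurable_hits n i)).
have k0 : 0 <= 1 / 4 :> R by lra.
(* [10] exceeds every [bnd i], so the event on the left contains [E] up to a null set. *)
have := half_plane_step rp (v := dir i) (a := thr i) (b := 10) hE k0.
have mlt := measurable_incr_lt rp n (dir i) 10.
rewrite -(fineK (_ : P (E `&` [set w | (dot (x n.+1 w - x n w) (dir i) < 10)%R]) \is a fin_num)%E); last first.
  by apply: fin_num_measure; exact: measurableI.
rewrite -(fineK (_ : P (E `&` [set w | (thr i <= dot (x n.+1 w - x n w) (dir i))%R]) \is a fin_num)%E); last first.
  by apply: fin_num_measure; exact: measurableI.
rewrite -EFinM lee_fin => h.
apply: le_trans (h _).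
  rewrite ler_wpM2l// -(pr_Ok mE); apply: fine_prob_le; [exact: measurableI|exact: measurableI|].
  move=> w [Ew okw]; split => //=; have [_ hb _] := okP okw.
  apply: le_lt_trans (hb n i) _; rewrite /bnd; case: i.2; lra.
move=> w Ew; apply: le_trans (step_law_quarter (oE w Ew)).
rewrite -[leRHS]mulr1 ler_wpM2l//; exact: step_law_le1.
Qed.

Lemma retreats_half n E i : history x n E -> (forall w, E w -> open_near (x^~ w) n i) ->
  (forall w, E w -> forall u, allowed (x^~ w) n (x n w + u) -> dot u (dir i) < 0 ->
     0 < dot u (dir (i.1, ~~ i.2))) ->
  2 * pr (E `&` [set w | retreats n i w]) <= pr (E `&` [set w | hits n i w]).
Proof.
move=> hE oE bE; have mE := history_measurable rp hE.
have mh : measurable [set w | hits n i w] by exact: (measurable_pred (measurable_hits n i)).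
have mr : measurable [set w | retreats n i w] by exact: (measurable_pred (measurable_retreats n i)).
have k0 : 0 <= 2 :> R by lra.
have := half_plane_step rp (v := dir i) (a := thr i) (b := 0) hE k0.
rewrite -(fineK (_ : P (E `&` [set w | (dot (x n.+1 w - x n w) (dir i) < 0)%R]) \is a fin_num)%E); last first.
  by apply: fin_num_measure; exact: measurableI.
rewrite -(fineK (_ : P (E `&` [set w | (thr i <= dot (x n.+1 w - x n w) (dir i))%R]) \is a fin_num)%E); last first.
  by apply: fin_num_measure; exact: measurableI.
rewrite -EFinM lee_fin; apply => w Ew.
by apply: step_law_back; [exact: oE|exact: bE].
Qed.

Definition gainw n w := gain (x^~ w) n (normal (x^~ w) n).

Lemma gainwE n : gainw n = fun w =>
  \sum_i (20 * thr i) * (supp (x^~ w) n (dir i) && hits n i w)%:R +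
  (\sum_i (-2) * (supp (x^~ w) n (dir i))%:R +
  (\sum_i thr i * (anchor (x^~ w) n (normal (x^~ w) n) i && hits n i w)%:R +
   \sum_i (- bnd i) * (anchor (x^~ w) n (normal (x^~ w) n) i && retreats n i w)%:R)).
Proof.
apply/funext => w; rewrite /gainw /gain -!big_split /=; apply: eq_bigr => i _.
rewrite -/(hits n i w) -/(retreats n i w).
by case: supp; case: anchor; case: hits; case: retreats => /=; ring.
Qed.

Section Pieces.
Context (n : nat).
Let mx i : measurable_fun setT (x i) := measurable_step rp i.

Lemma measurable_suppT i : measurable_fun setT (fun w => supp (x^~ w) n (dir i)).
Proof. by apply: measurable_supp. Qed.

Lemma measurable_anchorT i :
  measurable_fun setT (fun w => anchor (x^~ w) n (normal (x^~ w) n) i).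
Proof. by apply: measurable_anchor => //; exact: measurable_normal. Qed.

Lemma gainw_integral D : measurable D -> P.-integrable D (EFin \o gainw n) /\
  \int[P]_(w in D) gainw n w =
  \sum_i (20 * thr i) * pr (D `&` [set w | supp (x^~ w) n (dir i) && hits n i w]) +
  (\sum_i (-2) * pr (D `&` [set w | supp (x^~ w) n (dir i)]) +
  (\sum_i thr i * pr (D `&` [set w | anchor (x^~ w) n (normal (x^~ w) n) i && hits n i w]) +
   \sum_i (- bnd i) * pr (D `&` [set w | anchor (x^~ w) n (normal (x^~ w) n) i && retreats n i w]))).
Proof.
move=> mD.
pose ix := index_enum (Finite.clone _ (octant * bool)%type).
have [i1 e1] := comb_integral P ix (fun i => 20 * thr i) mD
  (fun i => measurable_and (measurable_suppT i) (measurable_hits n i)).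
have [i2 e2] := comb_integral P ix (fun i => -2) mD (fun i => measurable_suppT i).
have [i3 e3] := comb_integral P ix (fun i => thr i) mD
  (fun i => measurable_and (measurable_anchorT i) (measurable_hits n i)).
have [i4 e4] := comb_integral P ix (fun i => - bnd i) mD
  (fun i => measurable_and (measurable_anchorT i) (measurable_retreats n i)).
have i34 := integrableD mD i3 i4.
have i234 := integrableD mD i2 i34.
have i1234 := integrableD mD i1 i234.
rewrite gainwE; split; first exact: i1234.
by rewrite RintegralD// e1 RintegralD// e2 RintegralD// e3 e4.
Qed.

Lemma gain_mean E : history x n E -> (forall w, E w -> ~~ flat (x^~ w) n) ->
  1 / 20 * pr E <= \int[P]_(w in E `&` Ok) gainw n w.
Proof.
move=> hE nf.
(* [Ok] need not be a history event. What is used of it at time [n], that [normal] really is a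
   normal, is such an event and is intersected with [E]. *)
pose E1 := E `&` [set w | (normal (x^~ w) n != 0) && supp (x^~ w) n (normal (x^~ w) n)].
have mhx i : (i <= n)%N -> measurable_fun (setT : set (hist x n)) (x i) by exact: measurable_hist.
have mhn := measurable_normal mhx.
have hE1 : history x n E1.
  apply: historyI => //; apply: historyP; apply: measurable_and; last exact: measurable_supp.
  have m1 := measurable_fst_comp mhn; have m2 := measurable_snd_comp mhn.
  apply: measurable_neg.
  have -> : (fun w => normal (x^~ w) n == 0) =
      (fun w => ((normal (x^~ w) n).1 == 0) && ((normal (x^~ w) n).2 == 0)).
    by apply/funext => w; case: (normal _ _).
  by apply: measurable_and; apply: measurable_fun_eqr.
have E1E : E1 `&` Ok = E `&` Ok.
  apply/seteqP; split => w; first by move=> [[]].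
  by move=> [Ew okw]; split => //; split => //=; apply/andP; exact: ok_normal.
have mE := history_measurable rp hE; have mE1 := history_measurable rp hE1.
rewrite -E1E -(pr_Ok mE) -E1E (pr_Ok mE1).
have mI (b : T -> bool) : measurable_fun setT b -> measurable (E1 `&` [set w | b w]).
  by move=> mb; apply: measurableI => //; exact: measurable_pred.
have cut (b : T -> bool) : measurable_fun setT b ->
    pr (E1 `&` Ok `&` [set w | b w]) = pr (E1 `&` [set w | b w]).
  by move=> mb; rewrite setIAC pr_Ok//; exact: mI.
have mS := measurable_suppT; have mA := measurable_anchorT.
have mh := measurable_hits n; have mr := measurable_retreats n.
have [_ ->] := gainw_integral (measurableI _ _ mE1 mOk).
rewrite -!big_split /=.
have x0 w : x 0%N w = 0 by case: rp.
have cov : pr E1 <= \sum_i (pr (E1 `&` [set w | supp (x^~ w) n (dir i)]) +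
    pr (E1 `&` [set w | anchor (x^~ w) n (normal (x^~ w) n) i])).
  apply: le_trans (_ : \sum_i pr (E1 `&` [set w | supp (x^~ w) n (dir i) ||
     anchor (x^~ w) n (normal (x^~ w) n) i]) <= _).
    apply: cover_prob => // [i|w _]; first exact: measurable_or.
    have [/existsP [i si]|bad] := boolP (good (x^~ w) n); first by exists i; rewrite si.
    by eexists; apply/orP; right; rewrite /anchor bad; exact: eqxx.
  apply: ler_sum => i _.
  have mo := measurable_or (mS i) (mA i).
  rewrite (fine_probD P (mI _ mo) (measurable_pred (mS i))).
  apply: lerD; apply: fine_prob_le; rewrite /=.
  - by apply: measurableI; [exact: mI|exact: measurable_pred].
  - exact: mI.
  - by move=> w [[E1w _] sw].
  - by apply: measurableD; [exact: mI|exact: measurable_pred].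
  - exact: mI.
  - by move=> w [[E1w /orP[//|aw]] _].
apply: (@le_trans _ _ (1 / 20 * \sum_i (pr (E1 `&` [set w | supp (x^~ w) n (dir i)]) +
    pr (E1 `&` [set w | anchor (x^~ w) n (normal (x^~ w) n) i])))).
  by rewrite ler_wpM2l//; lra.
rewrite mulr_sumr; apply: ler_sum => i _.
rewrite !cut//; try exact: measurable_and.
have hS : history x n (E1 `&` [set w | supp (x^~ w) n (dir i)]).
  by apply: historyI => //; apply: historyP; exact: measurable_supp.
have hA : history x n (E1 `&` [set w | anchor (x^~ w) n (normal (x^~ w) n) i]).
  by apply: historyI => //; apply: historyP; exact: measurable_anchor.
have AE (a b : T -> bool) : E1 `&` [set w | a w && b w] = E1 `&` [set w | a w] `&` [set w | b w].
  apply/seteqP; split => w; first by move=> [? /andP[]].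
  by move=> [[? ?] ?]; split => //; apply/andP.
rewrite (AE (fun w => supp (x^~ w) n (dir i))).
rewrite !(AE (fun w => anchor (x^~ w) n (normal (x^~ w) n) i)).
have q1 := hits_quarter hS (fun w h => good_open h.2).
have Aw w : (E1 `&` [set w | anchor (x^~ w) n (normal (x^~ w) n) i]) w ->
  [/\ ~~ good (x^~ w) n, normal (x^~ w) n != 0, supp (x^~ w) n (normal (x^~ w) n),
      oct (normal (x^~ w) n) = i.1 & spread (x^~ w) n].
  move=> [[Ew /andP[n0 sn]] /andP[bad /eqP iE]]; split => //; first by rewrite iE.
  by apply: flatPn; [exact: x0|exact: nf].
have q2 : 1 / 4 * pr (E1 `&` [set w | anchor (x^~ w) n (normal (x^~ w) n) i]) <=
    pr (E1 `&` [set w | anchor (x^~ w) n (normal (x^~ w) n) i] `&` [set w | hits n i w]).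
  by apply: hits_quarter => // w /Aw [bad n0 sn oi _]; exact: bad_open oi.
have q3 : 2 * pr (E1 `&` [set w | anchor (x^~ w) n (normal (x^~ w) n) i] `&` [set w | retreats n i w]) <=
    pr (E1 `&` [set w | anchor (x^~ w) n (normal (x^~ w) n) i] `&` [set w | hits n i w]).
  apply: retreats_half => // w /Aw [bad n0 sn oi sp]; first exact: bad_open oi.
  exact: bad_back oi.
have g1 := fine_prob_ge0 P (E1 `&` [set w | supp (x^~ w) n (dir i)]).
have g2 := fine_prob_ge0 P (E1 `&` [set w | anchor (x^~ w) n (normal (x^~ w) n) i]).
(* Per unit of probability, a normal test direction yields at least [20 * (7 / 10) / 4 - 2 = 3 / 2].
   An anchor yields at least [(thr i - bnd i / 2) / 4], which is [1 / 20] for axes and [1 / 16] for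
   diagonals. *)
move: q1 q2 q3 g1 g2; rewrite /thr /bnd.
by case: i.2; lra.
Qed.

End Pieces.

End Mean.

(** * Linear growth *)

Section Paths.
Context {R : realType}.
Local Notation plane := (R * R)%type.
Implicit Types (y : nat -> plane) (i : octant * bool).

Lemma height_le y n v (M : R) : (forall k, (k <= n)%N -> dot (y k) v <= M) ->
  height y n v <= M.
Proof.
move=> h; rewrite /height -lerBrDr; apply: gap_le; first by rewrite subr_ge0 h.
by move=> k kn; rewrite dotBl lerB// h.
Qed.

Lemma heights_le y n (M : R) : (forall k i, (k <= n)%N -> dot (y k) (dir i) <= M) ->
  heights y n <= 16 * M.
Proof.
move=> h; apply: (@le_trans _ _ (\sum_(i : octant * bool) M)).
  by apply: ler_sum => i _; apply: height_le => k; exact: h.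
by rewrite sumr_const !card_prod !card_bool /= mulr_natl.
Qed.

Lemma heights_ge0 y n : y 0%N = 0 -> 0 <= heights y n.
Proof.
move=> y0; apply: sumr_ge0 => i _; have := gap_ge y (dir i) (leq0n n).
by rewrite /height y0 dotBl dot0l; lra.
Qed.

Lemma dot_le_time y n i : y 0%N = 0 ->
  (forall k i, dot (y k.+1 - y k) (dir i) <= bnd i) -> dot (y n) (dir i) <= 2 * n%:R.
Proof.
move=> y0 h; elim: n => [|n ih]; first by rewrite y0 dot0l mulr0.
have := h n i; rewrite dotBl -[n.+1]addn1 natrD.
have : bnd i <= 2 :> R by rewrite /bnd; case: i.2; lra.
by lra.
Qed.

Lemma deficit_ge0 y n w : 0 <= deficit y n w.
Proof. by rewrite /deficit; case: ifP => // _; rewrite le_min !gap_ge0. Qed.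

Lemma deficit_le y n w : y 0%N = 0 ->
  (forall k i, dot (y k.+1 - y k) (dir i) <= bnd i) -> deficit y n w <= 4 * n%:R.
Proof.
move=> y0 h; rewrite /deficit; case: ifP => _; first by rewrite mulr_ge0.
rewrite ge_min; apply/orP; left; pose i : octant * bool := (oct w, true).
rewrite -/(dir i); apply: gap_le => [|k kn]; first by rewrite mulr_ge0.
have := dot_le_time n (oppdir i) y0 h; have := dot_le_time k i y0 h.
have : k%:R <= n%:R :> R by rewrite ler_nat.
by rewrite dir_opp dotNr dotBl; lra.
Qed.

Lemma nonflat_le y m n : (m <= n)%N -> ~~ flat y m -> ~~ flat y n.
Proof.
move=> /subnKC <-; elim: (n - m)%N => [|k ih]; first by rewrite addn0.
by move=> /ih; rewrite addnS; apply: contra; exact: flatS.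
Qed.

(** Summing [gainP] leaves boundary terms: [heights y m] and the final deficit have the favourable
    sign, and the initial deficit is at most [4 * m]. *)
Lemma gain_telescope y m n : y 0%N = 0 -> (m <= n)%N -> ~~ flat y m ->
  (forall k, ~ blocked y k (y k.+1 - y k)) ->
  (forall k i, dot (y k.+1 - y k) (dir i) <= bnd i) ->
  (forall k, normal y k != 0 /\ supp y k (normal y k)) ->
  \sum_(m <= k < n) gain y k (normal y k) <= 20 * heights y n + 4 * m%:R.
Proof.
move=> y0 mn nf nb hb hn.
suff : \sum_(m <= k < n) gain y k (normal y k) <=
    20 * (heights y n - heights y m) - (deficit y n (normal y n) - deficit y m (normal y m)).
  have := heights_ge0 m y0; have := deficit_ge0 y n (normal y n).
  have := deficit_le m (normal y m) y0 hb.
  by lra.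
elim: n mn => [|n ih].
  by rewrite leqn0 => /eqP ->; rewrite big_geq// !subrr mulr0 subrr.
rewrite leq_eqVlt => /orP[/eqP <-|]; first by rewrite big_geq// !subrr mulr0 subrr.
rewrite ltnS => mn; rewrite big_nat_recr//=.
have [w0 sw] := hn n; have [w0' sw'] := hn n.+1.
have [_ st _] := turnP w0 sw (nb n).
have sp : spread y n by apply: flatPn => //; exact: nonflat_le nf.
have := gainP sp w0 w0' sw st sw' (hb n); have := ih mn.
by rewrite /=; lra.
Qed.

(* A test direction such that a unit step close to it is not parallel to [v]. *)
Definition escape (v : plane) : octant * bool :=
  if 0 < v.1 * v.2 then ((false, true, true), false)
  else if v.1 * v.2 < 0 then ((true, true, true), false)
  else if v.1 == 0 then ((true, true, true), true)
  else ((true, true, false), true).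

(** If [v] is off the axes, the hypotheses put [u] in a closed quadrant whose only point on the line
    of [v] is [0], and [u] is not [0]. If [v] is on an axis, [u] has a positive coordinate
    transverse to it. *)
Lemma escapeP (u v : plane) : v != 0 -> (forall i, dot u (dir i) <= bnd i) ->
  thr (escape v) <= dot u (dir (escape v)) -> det v u != 0.
Proof.
move=> v0 hb ht; apply/eqP => vu.
have := hb (true, true, true, true); have := hb (false, true, true, true).
have := hb (true, true, false, true); have := hb (true, false, false, true).
move: v0 ht vu; case: u v {hb} => [a b] [p q].
rewrite /det /dot /bnd /escape /thr /dir /axisdir /diagdir /=.
case: ltP => pq; [|case: ltP => pq'; [|case: (eqVneq p 0) => [->|p0]]] => v0 /= ht vu h1 h2 h3 h4.
- have a0 : a <= 0 by lra.
  have b0 : 0 <= b by lra.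
  have E : (p * p) * b = (p * q) * a.
    by rewrite -!mulrA; congr (p * _); rewrite mulrC in vu *; lra.
  have p0 : 0 < p * p.
    by rewrite -expr2 exprn_even_gt0//=; apply: contraTneq pq => ->; rewrite mul0r ltxx.
  have : 0 <= p * p * b by rewrite mulr_ge0// ltW.
  have : p * q * a <= 0 by rewrite mulr_ge0_le0// ltW.
  rewrite -E => e1 e2; have /eqP : p * p * b = 0 by lra.
  rewrite mulf_eq0 gt_eqF//= => /eqP bz.
  have /eqP : p * q * a = 0 by rewrite -E bz mulr0.
  by rewrite mulf_eq0 gt_eqF//= => /eqP az; lra.
- have a0 : 0 <= a by lra.
  have b0 : 0 <= b by lra.
  have E : (p * p) * b = (p * q) * a.
    by rewrite -!mulrA; congr (p * _); rewrite mulrC in vu *; lra.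
  have p0 : 0 < p * p.
    by rewrite -expr2 exprn_even_gt0//=; apply: contraTneq pq' => ->; rewrite mul0r ltxx.
  have : 0 <= p * p * b by rewrite mulr_ge0// ltW.
  have : p * q * a <= 0 by rewrite mulr_le0_ge0// ltW.
  rewrite -E => e1 e2; have /eqP : p * p * b = 0 by lra.
  rewrite mulf_eq0 gt_eqF//= => /eqP bz.
  have /eqP : p * q * a = 0 by rewrite -E bz mulr0.
  by rewrite mulf_eq0 lt_eqF//= => /eqP az; lra.
- move: vu; rewrite mul0r sub0r => /eqP; rewrite oppr_eq0 mulf_eq0 => /orP[/eqP q0|/eqP a0].
    by rewrite q0 eqxx in v0.
  by lra.
- have q0 : q = 0.
    have /eqP : p * q = 0 by lra.
    by rewrite mulf_eq0 (negPf p0) /= => /eqP.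
  move: vu; rewrite q0 mul0r subr0 => /eqP; rewrite mulf_eq0 (negPf p0) /= => /eqP b0.
  by lra.
Qed.

(** The hull lies on a line, so both perpendiculars are normal, and every step is nonnegative along
    one of them. *)
Lemma flat_open y n i : y 0%N = 0 -> y 1%N != 0 -> flat y n -> open_near y n i.
Proof.
move=> y0 y1 /forallP fl b u u1 _.
have h k : (k <= n)%N -> det (y 1%N) (y k) = 0.
  by move=> kn; exact: (eqP (fl (Ordinal (kn : (k < n.+1)%N)))).
have h' k : (k <= n)%N -> dot (y k - y n) (perp (y 1%N)) = 0.
  by move=> kn; rewrite det_perp; have := h k kn; have := h n (leqnn n); rewrite /det /=; lra.
have p0 := perp_neq0 y1.
have [us|us] := lerP 0 (dot u (perp (y 1%N))).
  by apply: (allowed_half_plane p0) => //; apply/suppP => k /h' ->.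
apply: (@allowed_half_plane _ _ _ (- perp (y 1%N))); rewrite ?oppr_eq0//.
  by apply/suppP => k /h'; rewrite dotNr => ->; rewrite oppr0.
by rewrite dotNr oppr_ge0 ltW.
Qed.

End Paths.

Lemma disjoint_prob d (T : measurableType d) (R : realType) (P : probability T R)
    (I : finType) (D : set T) (b : I -> T -> bool) :
  measurable D -> (forall i, measurable_fun setT (b i)) ->
  (forall w, \sum_i (b i w)%:R <= 1 :> R) ->
  \sum_i fine (P (D `&` [set w | b i w])) <= fine (P D).
Proof.
move=> mD mb h.
have [i1 e1] := comb_integral P (index_enum I) (fun=> 1) mD mb.
have <- : \sum_i 1 * fine (P (D `&` [set w | b i w])) = \sum_i fine (P (D `&` [set w | b i w])).
  by apply: eq_bigr => i _; rewrite mul1r.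
rewrite -e1 -[leRHS]mul1r -Rintegral_cst//; apply: le_Rintegral => //.
  apply: (integrableS measurableT) => //.
  exact: finite_measure_integrable_cst.
move=> w _; apply: le_trans (h w); apply: ler_sum => i _; by rewrite mul1r.
Qed.

Lemma linear_bounded_le0 (R : archiRealFieldType) (a b : R) :
  (forall n : nat, a * n%:R <= b) -> a <= 0.
Proof.
move=> h; rewrite leNgt; apply/negP => a0.
have := h (Num.truncn (b / a)).+1; rewrite leNgt => /negP; apply.
by rewrite mulrC -ltr_pdivrMr//; exact: truncnS_gt.
Qed.

Section Speed.
Context d (T : measurableType d) (R : realType) (P : probability T R).
Local Notation plane := (R * R)%type.
Context (x : nat -> T -> plane) (rp : rancher_process P x).
Context (Ok : set T) (mOk : measurable Ok) (POk : P (~` Ok) = 0%E)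
  (okP : forall w, Ok w -> regular_path x w).

Local Notation pr A := (fine (P A)).

Let x0 w : x 0%N w = 0. Proof. by case: rp. Qed.
Let mx i : measurable_fun setT (x i) := measurable_step rp i.

(** Hitting the escape direction has conditional probability at least [1 / 4] and takes the path off
    its line. This direction depends on [x 1], so the argument runs separately on the history events
    that fix its value. *)
Lemma flat_decay n : (0 < n)%N ->
  pr [set w | flat (x^~ w) n.+1] <= 3 / 4 * pr [set w | flat (x^~ w) n].
Proof.
move=> n0.
have mhx i : (i <= n)%N -> measurable_fun (setT : set (hist x n)) (x i) by exact: measurable_hist.
have mF m : (0 < m)%N -> measurable [set w | flat (x^~ w) m].
  by move=> m0; apply: measurable_pred; exact: measurable_flat.
pose E := [set w | flat (x^~ w) n && (x 1%N w != 0)].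
have hE : history x n E.
  apply: historyP; apply: measurable_and; first exact: measurable_flat.
  have m1 := measurable_fst_comp (mhx _ n0); have m2 := measurable_snd_comp (mhx _ n0).
  apply: measurable_neg.
  have -> : (fun w => x 1%N w == 0) = (fun w => ((x 1%N w).1 == 0) && ((x 1%N w).2 == 0)).
    by apply/funext => w; case: (x 1%N w).
  by apply: measurable_and; apply: measurable_fun_eqr.
have mE := history_measurable rp hE.
pose b (i : octant * bool) w := i == escape (x 1%N w).
have mhb i : measurable_fun (setT : set (hist x n)) (b i).
  rewrite /b /escape.
  have m1 := measurable_fst_comp (mhx _ n0); have m2 := measurable_snd_comp (mhx _ n0).
  have m12 := measurable_funM m1 m2.
  have -> : (fun w => i == escape (x 1%N w)) = (fun w =>
    if 0 < (x 1%N w).1 * (x 1%N w).2 then i == ((false, true, true), false)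
    else if (x 1%N w).1 * (x 1%N w).2 < 0 then i == ((true, true, true), false)
    else if (x 1%N w).1 == 0 then i == ((true, true, true), true)
    else i == ((true, true, false), true)).
    by apply/funext => w; rewrite /escape; do 3?[case: ifP => _].
  apply: measurable_fun_ifT => //; first exact: measurable_fun_ltr.
  apply: measurable_fun_ifT => //; first exact: measurable_fun_ltr.
  by apply: measurable_fun_ifT => //; exact: measurable_fun_eqr.
have hb i : history x n (E `&` [set w | b i w]).
  by apply: historyI => //; exact: historyP.
have mb i : measurable_fun setT (b i).
  move=> _ B mB; rewrite setTI.
  have := mhb i measurableT B mB; rewrite setTI; exact: (history_measurable rp).
have mEb i := history_measurable rp (hb i).
have mhit i := measurable_pred (measurable_hits rp n i).
have key i : pr (E `&` [set w | flat (x^~ w) n.+1] `&` [set w | b i w]) <=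
    3 / 4 * pr (E `&` [set w | b i w]).
  have q := hits_quarter rp mOk POk okP (i := i) (hb i).
  have {}q : 1 / 4 * pr (E `&` [set w | b i w]) <=
      pr (E `&` [set w | b i w] `&` [set w | hits x n i w]).
    by apply: q => w [/andP[fl x1] _]; apply: flat_open => //; exact: x0.
  have := fine_probD P (mEb i) (mhit i).
  have mFb : measurable (E `&` [set w | flat (x^~ w) n.+1] `&` [set w | b i w]).
    by rewrite setIAC; apply: measurableI => //; exact: mF.
  suff : pr (E `&` [set w | flat (x^~ w) n.+1] `&` [set w | b i w]) <=
      pr ((E `&` [set w | b i w]) `\` [set w | hits x n i w]) by lra.
  rewrite -(pr_Ok mOk POk mFb); apply: fine_prob_le.
  - exact: measurableI.
  - exact: measurableD.
  move=> w [[[Ew fl] bi] okw]; split => // hi.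
  have /andP[fln x1] := Ew; have [_ hbnd _] := okP okw.
  have /eqP iE : b i w := bi.
  have := @escapeP R (x n.+1 w - x n w) (x 1%N w) x1 (hbnd n).
  rewrite -iE => /(_ hi) /eqP; apply.
  have /forallP := fl => /(_ ord_max) /eqP /= e1.
  have /forallP := fln => /(_ ord_max) /eqP /= e2.
  by move: e1 e2; rewrite /det /=; lra.
apply: (@le_trans _ _ (pr (E `&` [set w | flat (x^~ w) n.+1]))).
  rewrite -(pr_Ok mOk POk (mF n.+1 isT)); apply: fine_prob_le.
  - by apply: measurableI => //; exact: mF.
  - by apply: measurableI => //; exact: mF.
  move=> w [/= fl okw]; have [_ _ x1] := okP okw; split => //.
  by apply/andP; split; [exact: flatS fl|exact/eqP].
apply: le_trans (cover_prob P _ mb _) _.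
- by apply: measurableI => //; exact: mF.
- by move=> w _; exists (escape (x 1%N w)); exact: eqxx.
apply: le_trans (ler_sum _ (fun i _ => key i)) _.
rewrite -mulr_sumr ler_wpM2l//.
apply: (@le_trans _ _ (pr E)).
  apply: disjoint_prob => // w; rewrite (bigD1 (escape (x 1%N w)))//= big1 ?addr0 => [|i].
    by rewrite /b eqxx.
  by rewrite /b => /negPf ->.
by apply: fine_prob_le => //; [exact: mF|move=> w /andP[]].
Qed.

Lemma flat_geometric n : pr [set w | flat (x^~ w) n.+1] <= (3 / 4) ^+ n.
Proof.
elim: n => [|n ih].
  rewrite expr0; apply: fine_prob_le1; apply: measurable_pred; exact: measurable_flat.
have h := flat_decay (ltn0Sn n).
have q : 0 <= 3 / 4 :> R by lra.
by rewrite exprS; exact: le_trans h (ler_wpM2l q ih).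
Qed.

(** * Slow paths have probability zero *)

(* The mean gain is at least [1 / 20] per step, whereas staying within distance
   [speed * k] of the origin bounds the gain per step by
   [20 * 16 * 2 * speed = 1 / 40]. *)
Definition speed : R := 1 / (160 * 160).

(** The squared form of [enorm (x k w) <= speed * k], polynomial in the coordinates. *)
Definition slow k w : bool := (x k w).1 ^+ 2 + (x k w).2 ^+ 2 <= (speed * k%:R) ^+ 2.

Definition slow_upto N m : set T := [set w | forall k, (N <= k <= m)%N -> slow k w].

Definition slow_from N : set T := [set w | forall k, (N <= k)%N -> slow k w].

Lemma slow_dot k w i : slow k w -> dot (x k w) (dir i) <= 2 * (speed * k%:R).
Proof.
rewrite /slow => h; have s0 : 0 <= speed * k%:R by rewrite mulr_ge0// /speed; lra.
move: h; move: (speed * k%:R) s0 => r r0; case: (x k w) => a b /= h.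
have a1 : `|a| <= r.
  rewrite -(ler_pXn2r (n := 2)) ?nnegrE// real_normK ?num_real//.
  by have := sqr_ge0 b; lra.
have b1 : `|b| <= r.
  rewrite -(ler_pXn2r (n := 2)) ?nnegrE// real_normK ?num_real//.
  by have := sqr_ge0 a; lra.
move: a1 b1; rewrite !ler_norml => /andP[a1 a2] /andP[b1 b2].
by rewrite /dot /dir /axisdir /diagdir; case: i => [[[[] []] []] []] /=; lra.
Qed.

Lemma measurable_slow_hist k n : (k <= n)%N -> measurable_fun (setT : set (hist x n)) (slow k).
Proof.
move=> kn; have m := @measurable_hist _ T R x _ _ kn.
apply: measurable_fun_ler => //; apply: measurable_funD; apply: measurable_funX;
  by [exact: measurable_fst_comp|exact: measurable_snd_comp].
Qed.

Lemma history_slow_upto N m : history x m (slow_upto N m).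
Proof.
have -> : slow_upto N m = [set w | [forall k : 'I_m.+1, (N <= k)%N ==> slow k w]].
  apply/seteqP; split => w /=.
    move=> h; apply/forallP => k; apply/implyP => Nk; apply: h.
    by rewrite Nk -ltnS ltn_ord.
  move=> /forallP h k /andP[Nk km].
  by have /implyP := h (Ordinal (km : (k < m.+1)%N)); apply.
apply: historyP; apply: measurable_forall => k; case: (N <= k)%N => /=.
  by apply: measurable_slow_hist; rewrite -ltnS.
exact: measurable_cst.
Qed.

Lemma slow_fromE N : slow_from N = \bigcap_m slow_upto N m.
Proof.
apply/seteqP; split => w.
  by move=> h m _ k /andP[Nk _]; exact: h.
by move=> h k Nk; apply: (h k I); rewrite Nk leqnn.
Qed.

Lemma measurable_slow_upto N m : measurable (slow_upto N m).
Proof. exact: (history_measurable rp (@history_slow_upto N m)). Qed.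

Lemma measurable_slow_from N : measurable (slow_from N).
Proof. by rewrite slow_fromE; apply: bigcap_measurable => // m _; exact: measurable_slow_upto. Qed.

(** Since [E] belongs to the history up to [m], the gains from [m] to [n] integrate over it to at
    least [(n - m) / 20 * P E]. Pathwise they are at most [n / 40] plus a constant on [slow_from N],
    and at most [640 * n] plus a constant elsewhere. Comparing the growth in [n] gives the claim. *)
Lemma slow_upto_bound N m : (0 < m)%N ->
  let E := slow_upto N m `&` [set w | ~~ flat (x^~ w) m] in
  1 / 40 * pr E <= 640 * pr (E `\` slow_from N).
Proof.
move=> m0; set E := _ `&` _ => /=.
have hF : history x m [set w | ~~ flat (x^~ w) m].
  apply: historyP; apply: measurable_neg; apply: measurable_flat => // i.
  exact: measurable_hist.
have hE : history x m E by apply: historyI => //; exact: history_slow_upto.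
have mE := history_measurable rp hE; have mS := measurable_slow_from N.
have mEO := measurableI _ _ mE mOk.
pose nonslow w : bool := `[< ~ slow_from N w >].
have mns : measurable_fun setT nonslow.
  apply: (measurable_fun_bool true); rewrite setTI.
  rewrite (_ : _ @^-1` _ = ~` slow_from N); first exact: measurableC.
  by apply/seteqP; split => w /=; [move=> /asboolP|move=> ?; apply/asboolP].
rewrite -subr_le0.
apply: (@linear_bounded_le0 _ _ (1 / 20 * m%:R + 640 * N%:R + 4 * m%:R + 0)) => n0.
pose n := maxn n0 m.
have mn : (m <= n)%N by rewrite leq_maxr.
have low : (1 / 20 * pr E) * (n%:R - m%:R) <= \int[P]_(w in E `&` Ok)
    (\sum_(m <= k < n) gainw x k w) /\
    P.-integrable (E `&` Ok) (EFin \o (fun w => \sum_(m <= k < n) gainw x k w)).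
  elim: (n) mn => [|k ih].
    by rewrite leqn0 (gtn_eqF m0).
  rewrite leq_eqVlt => /orP[/eqP <-|].
    have -> : (fun w => \sum_(m <= k < m) gainw x k w) = cst 0.
      by apply/funext => w; rewrite big_geq.
    by rewrite subrr mulr0 Rintegral_cst// mul0r; split => //; exact: integrable0.
  rewrite ltnS => mk; have [ih1 ih2] := ih mk.
  have [ig _] := gainw_integral rp k mEO.
  have -> : (fun w => \sum_(m <= j < k.+1) gainw x j w) =
      (fun w => \sum_(m <= j < k) gainw x j w + gainw x k w).
    by apply/funext => w; rewrite big_nat_recr.
  split; last by apply: eq_integrable (integrableD mEO ih2 ig) => // w _; rewrite /= EFinD.
  rewrite RintegralD//.
  have := gain_mean rp mOk POk okP (historyS mk hE).
  have nf w : E w -> ~~ flat (x^~ w) k by move=> [_ fl]; exact: nonflat_le fl.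
  by move=> /(_ nf); rewrite -[k.+1]addn1 natrD; lra.
have [low1 low2] := low.
(* Here [640 = 20 * 16 * 2]: the weight of [heights], the number of indices, and the factor [2] of
   [slow_dot] and [dot_le_time]. The term with [N] covers the times before [N], when only
   [dot_le_time] is available; [K2] replaces slowness by it at all times. *)
pose K1 : R := 640 * (speed * n%:R) + 640 * N%:R + 4 * m%:R.
pose K2 : R := 640 * n%:R.
have [ins ens] := bool_integral P K2 mEO mns.
have up : \int[P]_(w in E `&` Ok) (\sum_(m <= k < n) gainw x k w) <=
    K1 * pr (E `&` Ok) + K2 * pr (E `&` Ok `&` [set w | nonslow w]).
  rewrite -Rintegral_cst// -ens -RintegralD//; last exact: finite_measure_integrable_cst.
  apply: le_Rintegral => //.
    exact: eq_integrable (integrableD mEO (finite_measure_integrable_cst _ K1 mEO) ins).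
  move=> w [[sl fl] okw]; have [nb hb _] := okP okw.
  have tel := gain_telescope (x0 w) mn fl nb hb (ok_normal okP okw).
  apply: le_trans tel _; rewrite /K1 /K2.
  have [sf|nsf] := boolP (nonslow w).
    have : heights (x^~ w) n <= 16 * (2 * n%:R).
      apply: heights_le => k i kn; apply: le_trans (dot_le_time k i (x0 w) hb) _.
      by rewrite ler_wpM2l// ler_nat.
    rewrite mulr1; have : 0 <= speed * n%:R by rewrite mulr_ge0// /speed; lra.
    have : 0 <= N%:R :> R by [].
    by lra.
  rewrite mulr0 addr0.
  have sw : slow_from N w by apply: contrapT => h; move/negP: nsf; apply; apply/asboolP.
  have sp0 : 0 <= speed by rewrite /speed; lra.
  have : heights (x^~ w) n <= 16 * (2 * (speed * n%:R) + 2 * N%:R).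
    apply: heights_le => k i kn; have [Nk|kN] := leqP N k.
      have := slow_dot i (sw k Nk).
      have : speed * k%:R <= speed * n%:R by rewrite ler_wpM2l// ler_nat.
      have : 0 <= N%:R :> R by [].
      by lra.
    apply: le_trans (dot_le_time k i (x0 w) hb) _.
    have : k%:R <= N%:R :> R by rewrite ler_nat ltnW.
    have : 0 <= speed * n%:R by rewrite mulr_ge0.
    by lra.
  by lra.
have e1 : pr (E `&` Ok) = pr E by exact: pr_Ok.
have e2 : pr (E `&` Ok `&` [set w | nonslow w]) = pr (E `\` slow_from N).
  rewrite setIAC pr_Ok//; last first.
    by apply: measurableI => //; exact: measurable_pred.
  congr fine; congr (P _); apply/seteqP; split => w [Ew ns]; split => //.
    exact/asboolP.
  by apply/asboolP.
have p1 := fine_prob_le1 P mE; have p0 := fine_prob_ge0 P E.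
have p2 := fine_prob_ge0 P (E `\` slow_from N).
have nn : n0%:R <= n%:R :> R by rewrite ler_nat leq_maxl.
have N0 : 0 <= N%:R :> R by [].
have M0 : 0 <= m%:R :> R by [].
have A0 : 0 <= n0%:R :> R by [].
move: low1 up; rewrite e1 e2 /K1 /K2 /speed.
move: (pr E) (pr (E `\` slow_from N)) p1 p0 p2 => p q p1 p0 p2.
move: (n%:R : R) (n0%:R : R) (m%:R : R) (N%:R : R) nn N0 M0 A0 => a a0 b c nn N0 M0 A0 l1 l2.
have {l1 l2} h := le_trans l1 l2.
have bp : b * p <= b by rewrite ler_piMr.
have cp : c * p <= c by rewrite ler_piMr.
have h' : (1 / 40 * p - 640 * q) * a <= 1 / 20 * b + 640 * c + 4 * b by nra.
have [q0|q0] := lerP 0 (1 / 40 * p - 640 * q).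
  by rewrite addr0; apply: le_trans h'; rewrite ler_wpM2l.
have : (1 / 40 * p - 640 * q) * a0 <= 0 by rewrite mulr_le0_ge0// ltW.
by lra.
Qed.

(** Up to a flat part of probability at most [(3 / 4) ^+ m], [slow_from N] lies in the event of
    [slow_upto_bound]. The bound there is a multiple of the probability of being slow up to [m.+1]
    but not forever; these events decrease to the empty set. *)
Lemma slow_from_null N : P (slow_from N) = 0%E.
Proof.
have mS := measurable_slow_from N.
have mF m : measurable [set w | flat (x^~ w) m.+1].
  by apply: measurable_pred; exact: measurable_flat.
pose F m := slow_upto N m.+1 `\` slow_from N.
have mU m := measurable_slow_upto N m.
have mFm m : measurable (F m) by apply: measurableD.
have capF : \bigcap_m F m = set0.
  rewrite -subset0 => w h; have [_ nS] := h 0%N I; apply: nS.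
  by move=> k Nk; have [+ _] := h k I; apply; rewrite Nk leqnSn.
have cF : (P \o F) @ \oo --> P (\bigcap_m F m).
  apply: nonincreasing_cvg_mu => //.
  - by rewrite (le_lt_trans (probability_le1 _ _))// ltry.
  - by rewrite capF.
  move=> p q pq; apply/subsetPset => w [h nS]; split => // k /andP[Nk kp].
  by apply: h; rewrite Nk (leq_trans kp).
rewrite capF measure0 in cF.
have cf := fine_cvg cF.
have cg : ((3 / 4 : R) ^+ m) @[m --> \oo] --> (0 : R).
  by apply: cvg_expr; rewrite ger0_norm; lra.
have bound m : pr (slow_from N) <= 40 * 640 * pr (F m) + (3 / 4) ^+ m.
  pose E := slow_upto N m.+1 `&` [set w | ~~ flat (x^~ w) m.+1].
  have mE : measurable E.
    apply: measurableI => //; rewrite (_ : [set w | _] = ~` [set w | flat (x^~ w) m.+1]).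
      exact: measurableC.
    by apply/seteqP; split => w /=; move/negP.
  have hE : 1 / 40 * pr E <= 640 * pr (E `\` slow_from N) by exact: slow_upto_bound.
  have hEF : pr (E `\` slow_from N) <= pr (F m).
    by apply: fine_prob_le => //; [exact: measurableD|move=> w [[]]].
  have h1 := fine_probD P mS (mF m).
  have h2 : pr (slow_from N `&` [set w | flat (x^~ w) m.+1]) <= (3 / 4) ^+ m.
    apply: le_trans (flat_geometric m); apply: fine_prob_le => //.
    exact: measurableI.
  have h3 : pr (slow_from N `\` [set w | flat (x^~ w) m.+1]) <= pr E.
    apply: fine_prob_le => //; first exact: measurableD.
    move=> w [h nf]; split; last exact/negP.
    by move=> k /andP[Nk _]; exact: h.
  by rewrite h1; lra.
have le0 : pr (slow_from N) <= 40 * 640 * 0 + 0.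
  have c1 : (40 * 640 * pr (F m)) @[m --> \oo] --> (40 * 640 * 0 : R).
    by apply: cvgM; [exact: cvg_cst|exact: cf].
  have c0 : (pr (slow_from N)) @[m --> \oo] --> pr (slow_from N) by exact: cvg_cst.
  apply: ler_cvg_to c0 (cvgD c1 cg) _.
  by apply: nearW => m; exact: bound.
apply/eqP; rewrite eq_le measure_ge0 andbT.
rewrite -(fineK (_ : P (slow_from N) \is a fin_num)) ?fin_num_measure// lee_fin.
by move: le0; rewrite mulr0 addr0.
Qed.

End Speed.

Theorem theorem1 (R : realType) :
  exists2 s : R, 0 < s &
    forall (d : measure_display) (T : measurableType d) (P : probability T R)
      (x : nat -> T -> R * R),
      rancher_process P x ->
      {ae P, forall w,
        (s%:E <= limn_esup (fun n : nat => (enorm (x n w) / n%:R)%:E))%E}.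
Proof.
exists (@speed R); first by rewrite /speed; lra.
move=> d T P x rp; have [N [mN PN hN]] := ae_regular rp.
have mOk := measurableC mN.
have POk : P (~` ~` N) = 0%E by rewrite setCK.
have okP w : (~` N) w -> regular_path x w.
  by move=> nN; apply: contrapT => h; apply: nN; exact: hN.
apply: (negligibleS (A := \bigcup_k slow_from x k)); last first.
  apply: negligible_bigcup => k; apply/negligibleP.
    exact: (measurable_slow_from rp).
  exact: (slow_from_null rp mOk POk okP).
move=> w /= /negP; rewrite -ltNge => /ereal_inf_lt [_ [A [k _ kA] <-] h].
(* A limsup below [speed] keeps the ratio below [speed] on a tail; [maxn k 1] excludes [n = 0],
   where the ratio carries no information. *)
exists (maxn k 1) => // n; rewrite geq_max => /andP[kn n1].
have := le_lt_trans (ereal_sup_ubound _) h => /(_ (enorm (x n w) / n%:R)%:E).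
rewrite lte_fin ltr_pdivrMr ?ltr0n// => hn.
have {hn} : enorm (x n w) < speed R * n%:R by apply: hn; exists n => //; exact: kA.
have s0 : 0 <= speed R * n%:R by rewrite mulr_ge0// /speed; lra.
rewrite /slow /enorm => hn.
rewrite -(sqr_sqrtr (_ : 0 <= (x n w).1 ^+ 2 + (x n w).2 ^+ 2)).
  by rewrite ler_sqr ?nnegrE ?sqrtr_ge0// ltW.
by rewrite addr_ge0 ?sqr_ge0.
Qed.
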